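(* Assume the following. (i) For all $t\in\Theta$, $\varphi_t$ is invertible and increasing from $I_1$ to $I_2$, where $I_1,I_2$ are subsets of $\mathbb{R}$. (ii) For all $x\in I_2$, the map $t\mapsto\varphi_t^{-1}(x)$ is continuously differentiable on $\Theta$, with derivative denoted $\partial\varphi_t^{-1}(x)$. (iii) For all $t\in\Theta$, $\mathbb{E}\big[|\varphi_t^{-1}(\varphi_\theta(\varepsilon))|^2\big]<+\infty$. (iv) For every compact $B\subset\Theta$, $\mathbb{E}\big[\sup_{t\in B}|\partial\varphi_t^{-1}(\varphi_\theta(\varepsilon))|^4\big]<+\infty$. (v) $a<b$ are such that $[a,b]\subset\Theta$, $\theta\in\,]a,b[$, and $(t-\theta)M'(t)>0$ for all $t\in[a,b]$ with $t\neq\theta$. Let $(\gamma_n)_{n\ge1}$ be a decreasing sequence of positive real numbers with $\sum_{n\ge1}\gamma_n=+\infty$ and $\sum_{n\ge1}\gamma_n^2<+\infty$, and let $(\widehat\theta_n)_{n\ge0}$ be the projected Robbins-Monro sequence defined in the context. Then $\widehat\theta_n$ converges almost surely to $\theta$ as $n\to\infty$.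
   Context: $\Theta\subset\mathbb{R}$ is an interval, $\theta\in\Theta$ is an (unknown) parameter, and $(\varphi_t)_{t\in\Theta}$ is a (known) family of real functions. $(\varepsilon_n)_{n\ge0}$ is a sequence of independent identically distributed real random variables with values in $I_1$, and $X_n=\varphi_\theta(\varepsilon_n)$ for all $n\ge0$. $\varepsilon$ and $X$ denote random variables with the same distribution as $\varepsilon_n$ and $X_n$, with $X=\varphi_\theta(\varepsilon)$. The function $M$ is defined on $\Theta$ by $$M(t)=\mathbb{E}\big[|\varphi_t^{-1}(\varphi_\theta(\varepsilon))-\varepsilon|^2\big],$$ and under (i)--(iv) it is continuously differentiable with $$M'(t)=-2\,\mathbb{E}\big[\partial\varphi_t^{-1}(X)\,(\varepsilon-\varphi_t^{-1}(X))\big].$$ Let $\pi_{[a;b]}$ be the projection of $\mathbb{R}$ onto $[a,b]$: $\pi_{[a;b]}(x)=x$ if $a\le x\le b$, $=a$ if $x\le a$, $=b$ if $x\ge b$. The projected Robbins-Monro sequence is defined by a deterministic initial value $\widehat\theta_0\in[a,b]$ and, for $n\ge0$, $$\widehat\theta_{n+1}=\pi_{[a;b]}\big(\widehat\theta_n-\gamma_{n+1}T_{n+1}\big),\qquad T_{n+1}=-2\,\partial\varphi_{\widehat\theta_n}^{-1}(X_{n+1})\big(\varepsilon_{n+1}-\varphi_{\widehat\theta_n}^{-1}(X_{n+1})\big).$$ *)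

(* Defs.v *)
From HB Require Import structures.
From mathcomp Require Import all_boot all_order all_algebra.
From mathcomp Require Import all_classical all_reals all_analysis.

Set Implicit Arguments.
Unset Strict Implicit.
Unset Printing Implicit Defensive.

Import Order.TTheory GRing.Theory Num.Theory.
Import numFieldNormedType.Exports.

Local Open Scope classical_set_scope.
Local Open Scope ring_scope.

(* The derivative of [f] relative to [D]: the limit of the difference quotient
   is taken along [s] in [D] with [s != t]. It is the usual derivative at
   interior points of [D] and the one-sided one at the end points of an
   interval; the values of [f] outside [D] are irrelevant. *)
Definition derivable_within {R : realType} (D : set R) (f : R -> R) (t : R) :
    Prop :=
  cvg ((f s - f t) / (s - t) @[s --> within D t^']).

Definition derive_within {R : realType} (D : set R) (f : R -> R) (t : R) : R :=
  lim ((f s - f t) / (s - t) @[s --> within D t^']).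

Definition C1_on {R : realType} (D : set R) (f : R -> R) : Prop :=
  (forall t, D t -> derivable_within D f t) /\
  {within D, continuous (derive_within D f)}.

Definition independent_rvs {d : measure_display} {T : measurableType d}
    {R : realType} (P : probability T R) (X : nat -> {RV P >-> R}) : Prop :=
  forall (J : seq nat) (B : nat -> set R), uniq J ->
    (forall j, measurable (B j)) ->
    P (\bigcap_(j in [set` J]) (X j @^-1` B j)) =
    (\prod_(j <- J) P (X j @^-1` B j))%E.

Definition same_distribution {d : measure_display} {T : measurableType d}
    {R : realType} (P : probability T R) (X Y : {RV P >-> R}) : Prop :=
  forall B : set R, measurable B -> distribution P X B = distribution P Y B.

Section RobbinsMonro.
Context {R : realType}.
Variables (Theta I1 : set R) (phi : R -> R -> R) (theta : R).

(* [phi t] is a total function of which only the restriction to [I1] matters;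
   [phi_inv t] is the inverse of that restriction. *)
Definition phi_inv (t x : R) : R := pinv I1 (phi t) x.

Definition dphi_inv (t x : R) : R := derive_within Theta (phi_inv ^~ x) t.

(* [fine] only turns a finite expectation into a real number. *)
Definition M {d : measure_display} {T : measurableType d} (P : probability T R)
    (eps : {RV P >-> R}) (t : R) : R :=
  fine 'E_P[fun w => `|phi_inv t (phi theta (eps w)) - eps w| ^+ 2].

Definition proj (a b x : R) : R :=
  if x <= a then a else if b <= x then b else x.

Fixpoint theta_hat {T : Type} (a b theta0 : R) (gamma : nat -> R)
    (eps_ : nat -> T -> R) (n : nat) (w : T) {struct n} : R :=
  if n is m.+1 then
    let th := theta_hat a b theta0 gamma eps_ m w in
    let e := eps_ m.+1 w in
    let X := phi theta e in
    let T_ := - 2 * dphi_inv th X * (e - phi_inv th X) in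
    proj a b (th - gamma m.+1 * T_)
  else theta0.

End RobbinsMonro.

(* Main.v *)
(* Write V_n = (theta_n - theta)^2. Since the projection is a contraction towards
   theta and T_(n+1) has conditional mean M'(theta_n) and bounded conditional second
   moment C, one has, with g_n = gamma_(n+1) and on every event of the past,
     E V_(n+1) <= E V_n - 2 g_n E[(theta_n - theta) M'(theta_n)] + C g_n^2.
   As sum gamma_n = +oo and (t - theta) M'(t) is bounded below away from theta, E V_n
   is small for arbitrarily large n; the maximal inequality for the almost
   supermartingale V_n, started at such an n, turns this into almost sure
   convergence, without the martingale convergence theorem.

   Conditional expectations are avoided by integrating over events of the sigma-algebra
   generated by the first noises; the current estimate is frozen by approximating it
   with simple functions. The set I_1 need not be Borel, so that functions of the
   noise are first replaced by Borel functions that agree with them on I_1. *)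
Require Import Defs.
From HB Require Import structures.
From mathcomp Require Import all_boot all_order all_algebra.
From mathcomp Require Import all_classical all_reals all_analysis.
From mathcomp Require Import measurable_realfun ring lra.
Import Order.TTheory GRing.Theory Num.Theory.
Import numFieldNormedType.Exports.
Local Open Scope classical_set_scope.
Local Open Scope ring_scope.

Set Implicit Arguments.
Unset Strict Implicit.
Unset Printing Implicit Defensive.

(** * Independence and freezing *)

Section frozen_integral.
Context {d : measure_display} {T : measurableType d} {R : realType}.
Variable P : probability T R.

(** Independence of [A] from the sigma-algebra generated by [e]. It is stated one event at a time
    because the past enters only through its events. *)
Definition indep_event (e : T -> R) (A : set T) : Prop :=
  forall B : set R, measurable B ->
    P (A `&` e @^-1` B) = (P A * P (e @^-1` B))%E.

Lemma ge0_integral_mrestr (mu : {measure set T -> \bar R}) (A : set T)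
    (mA : measurable A) (h : T -> \bar R) :
  measurable_fun [set: T] h -> (forall w, (0 <= h w)%E) ->
  (\int[mrestr mu mA]_w h w = \int[mu]_(w in A) h w)%E.
Proof.
move=> mh h0; rewrite [LHS](@ge0_negligible_integral _ _ _ _ setT (~` A))//=.
- rewrite setTD setCK; apply: eq_measure_integral => B mB BA.
  by rewrite /= /mrestr setIidl.
- exact: measurableC.
- by rewrite /= /mrestr setICl measure0.
Qed.

(** Both sides integrate [phi] against a Borel measure: the image under [e] of [P] restricted to
    [A], and the law of [e0] scaled by [P A]. Independence and equality of laws identify the two
    measures. *)
Lemma ge0_integral_indep_event (e e0 : T -> R) (A : set T)
    (phi : R -> \bar R) : measurable_fun [set: T] e ->
  measurable_fun [set: T] e0 -> measurable A -> indep_event e A ->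
  (forall B, measurable B -> P (e @^-1` B) = P (e0 @^-1` B)) ->
  measurable_fun [set: R] phi -> (forall x, (0 <= phi x)%E) ->
  (\int[P]_(w in A) phi (e w) = P A * \int[P]_w phi (e0 w))%E.
Proof.
move=> me me0 mA eA ee0 mphi phi0.
rewrite -(@ge0_integral_mrestr P A mA (phi \o e))//; last 2 first.
- exact: (measurableT_comp mphi me).
- by move=> w; exact: phi0.
rewrite -(@ge0_integral_pushforward _ _ _ _ _ e me _ setT phi)//.
rewrite -(@ge0_integral_pushforward _ _ _ _ _ e0 me0 P setT phi)//.
have PA0 : 0 <= fine (P A) by rewrite fine_ge0.
have PAE : P A = (NngNum PA0)%:num%:E by rewrite /= fineK// fin_num_measure.
rewrite PAE -ge0_integral_mscale//.
apply: eq_measure_integral => B mB _ /=.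
by rewrite /pushforward /mrestr /mscale/= fineK ?fin_num_measure// setIC eA// ee0.
Qed.

Lemma integral_indep_event (e e0 : T -> R) (A : set T) (phi : R -> R) :
  measurable_fun [set: T] e -> measurable_fun [set: T] e0 ->
  measurable A -> indep_event e A ->
  (forall B, measurable B -> P (e @^-1` B) = P (e0 @^-1` B)) ->
  measurable_fun [set: R] phi -> P.-integrable setT (EFin \o (phi \o e0)) ->
  \int[P]_(w in A) phi (e w) = fine (P A) * \int[P]_w phi (e0 w).
Proof.
move=> me me0 mA eA ee0 mphi iphi.
have /measurable_EFinP mE := mphi.
have pE (u : T -> R) w :
    (fun x => (phi (u x))%:E)^\+%E w = (EFin \o phi)^\+%E (u w).
  by rewrite !funeposE.
have nE (u : T -> R) w :
    (fun x => (phi (u x))%:E)^\-%E w = (EFin \o phi)^\-%E (u w).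
  by rewrite !funenegE.
have E1 : (\int[P]_(w in A) (fun x => (phi (e x))%:E)^\+ w =
   P A * \int[P]_w (fun x => (phi (e0 x))%:E)^\+ w)%E.
  under eq_integral do rewrite pE; under [in RHS]eq_integral do rewrite pE.
  apply: ge0_integral_indep_event => //; exact: measurable_funepos.
have E2 : (\int[P]_(w in A) (fun x => (phi (e x))%:E)^\- w =
   P A * \int[P]_w (fun x => (phi (e0 x))%:E)^\- w)%E.
  under eq_integral do rewrite nE; under [in RHS]eq_integral do rewrite nE.
  apply: ge0_integral_indep_event => //; exact: measurable_funeneg.
rewrite /Rintegral integralE E1 E2 [in RHS]integralE.
have ip := integrable_pos_fin_num measurableT iphi.
have im := integrable_neg_fin_num measurableT iphi.
have PA : P A \is a fin_num by rewrite fin_num_measure.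
rewrite fineB ?fin_numM// fineB// mulrBr.
by rewrite !fineM.
Qed.
End frozen_integral.

(** * Dominated convergence for real integrals and approximation by simple functions *)

Section sequences_of_functions.
Import HBNNSimple.
Context {d : measure_display} {T : measurableType d} {R : realType}.

Lemma dominated_cvg_Rintegral (mu : {measure set T -> \bar R}) (D : set T)
    (F : nat -> T -> R) (f g : T -> R) : measurable D ->
  (forall n, measurable_fun D (F n)) ->
  (forall w, D w -> F n w @[n --> \oo] --> f w) ->
  mu.-integrable D (EFin \o g) ->
  (forall n w, D w -> `|F n w| <= g w) ->
  \int[mu]_(w in D) F n w @[n --> \oo] --> \int[mu]_(w in D) f w.
Proof.
move=> mD mF Ff ig Fg.
have mf : measurable_fun D f by exact: measurable_fun_cvg Ff.
have [||//|//|iF _ /=] := @dominated_convergence _ _ _ mu D mD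
    (fun n w => (F n w)%:E) (EFin \o f) (EFin \o g) _ _ _ ig.
- by move=> n; exact/measurable_EFinP.
- exact/measurable_EFinP.
- apply: aeW => w Dw; apply: cvg_EFin; last exact: Ff.
  by apply: nearW.
- by apply: aeW => w n Dw; rewrite lee_fin Fg.
by move=> h; apply: fine_cvg; rewrite fineK//; exact: integrable_fin_num.
Qed.

(** The shift [Y - a] is nonnegative, so its simple approximations from below lie between 0 and
    [Y - a]; shifting back keeps them in [[a, b]]. The finite range is what later allows slicing by
    values. *)
Lemma simple_approximation (a b : R) (Y : T -> R) :
  measurable_fun [set: T] Y -> (forall w, a <= Y w <= b) ->
  exists h : nat -> T -> R,
    [/\ forall n, measurable_fun [set: T] (h n),
        forall n w, a <= h n w <= b,
        forall n, exists s : seq R, forall w, h n w \in s &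
        forall w, h n w @[n --> \oo] --> Y w].
Proof.
move=> mY Yab.
have mYa : measurable_fun [set: T] (fun w => (Y w - a)%:E).
  by apply/measurable_EFinP; exact: measurable_funB.
have Ya0 w : [set: T] w -> (0 <= (Y w - a)%:E)%E.
  by rewrite lee_fin subr_ge0; case/andP: (Yab w).
pose k := nnsfun_approx measurableT mYa.
exists (fun n w => a + k n w); split.
- by move=> n; exact: measurable_funD.
- move=> n w; rewrite lerDl fun_ge0/=.
  have : ((k n w)%:E <= (Y w - a)%:E)%E.
    by rewrite /k nnsfun_approxE; exact: le_approx.
  rewrite lee_fin lerBrDl => /le_trans; apply.
  by case/andP: (Yab w).
- move=> n; have /finite_seqP[s sE] := @fimfunP _ _ (k n).
  exists (map (+%R a) s) => w; apply: map_f.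
  have : [set` s] (k n w) by rewrite -sE; exists w.
  by [].
- move=> w; rewrite -[X in _ --> X](subrKC a).
  apply: cvgD; first exact: cvg_cst.
  by have /fine_cvgP[_] := @cvg_nnsfun_approx _ _ _ _ measurableT _ mYa Ya0 w I.
Qed.

End sequences_of_functions.

(** * Functions of a parameter and a noise, and their measurable superposition *)

Section caratheodory.
Context {R : realType}.
Variables (a b : R) (J : set R) (f : R -> R -> R).

(** Measurability in the noise is asked on the whole line, continuity in the parameter only for
    noises in [J], which need not be Borel. Continuity is sequential, as dominated convergence
    requires. *)
Definition caratheodory : Prop :=
  (forall t, a <= t <= b -> measurable_fun [set: R] (f t)) /\
  (forall x (u : nat -> R) t, J x -> (forall n, a <= u n <= b) ->
    a <= t <= b -> u n @[n --> \oo] --> t ->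
    f (u n) x @[n --> \oo] --> f t x).

Hypothesis cf : caratheodory.

(** The preimage of [B] is a finite union of slices, one per value of [h], and on each slice the
    parameter is constant. *)
Lemma measurable_caratheodory_simple {d} {T : measurableType d} (h e : T -> R)
    (s : seq R) :
  measurable_fun [set: T] h -> measurable_fun [set: T] e ->
  (forall w, a <= h w <= b) -> (forall w, h w \in s) ->
  measurable_fun [set: T] (fun w => f (h w) (e w)).
Proof.
move=> mh me hab hs _ B mB; rewrite setTI.
rewrite [X in measurable X](_ : _ =
  \bigcup_(t in [set t | t \in s /\ a <= t <= b])
    (h @^-1` [set t] `&` (f t \o e) @^-1` B)).
  apply: fin_bigcup_measurable.
    apply: (@sub_finite_set _ _ [set` s]); last exact: finite_seq.
    by move=> t [].
  move=> t [_ tab]; apply: measurableI.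
    by rewrite -[X in measurable X]setTI; exact: mh.
  rewrite -[X in measurable X]setTI.
  exact: (measurableT_comp (cf.1 _ tab) me).
apply/seteqP; split => [w Bw|w [t _ [/= -> //]]].
by exists (h w); [split; [exact: hs|exact: hab]|split].
Qed.

(** Continuity in the parameter makes this a pointwise limit of the finitely valued case. *)
Lemma measurable_caratheodory {d} {T : measurableType d} (Y e : T -> R) :
  measurable_fun [set: T] Y -> measurable_fun [set: T] e ->
  (forall w, a <= Y w <= b) -> (forall w, J (e w)) ->
  measurable_fun [set: T] (fun w => f (Y w) (e w)).
Proof.
move=> mY me Yab eJ.
have [h [mh hab hs hY]] := simple_approximation mY Yab.
apply: (@measurable_fun_cvg _ _ _ setT (fun n w => f (h n w) (e w))).
  by move=> n; have [s hns] := hs n; exact: measurable_caratheodory_simple hns.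
by move=> w _; apply: cf.2.
Qed.

End caratheodory.

(** * Averaging out an independent noise while the parameter is frozen *)

Section freezing.
Context {d : measure_display} {T : measurableType d} {R : realType}.
Variables (P : probability T R) (a b : R) (J : set R).
Variables (f : R -> R -> R) (S : R -> R) (e e0 : T -> R).
Hypothesis cf : caratheodory a b J f.
Hypotheses (me : measurable_fun [set: T] e) (me0 : measurable_fun [set: T] e0).
Hypotheses (eJ : forall w, J (e w)) (e0J : forall w, J (e0 w)).
Hypothesis ee0 : forall B, measurable B -> P (e @^-1` B) = P (e0 @^-1` B).
Hypotheses (mS : measurable_fun [set: R] S)
  (iS : P.-integrable [set: T] (EFin \o (S \o e0))).
Hypothesis fS : forall t x, a <= t <= b -> J x -> `|f t x| <= S x.

Local Notation g t := (\int[P]_w f t (e0 w)).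

Lemma integrable_identically_distributed (phi : R -> R) :
  measurable_fun [set: R] phi ->
  P.-integrable [set: T] (EFin \o (phi \o e0)) ->
  P.-integrable [set: T] (EFin \o (phi \o e)).
Proof.
move=> mphi /integrableP[_ +]; move=> iphi; apply/integrableP; split.
  by apply/measurable_EFinP; exact: measurableT_comp.
apply: le_lt_trans iphi.
(* The whole space is independent of [e], so equality of laws transfers the integral of the absolute
   value. *)
rewrite (ge0_integral_indep_event (phi := fun x => `|(phi x)%:E|%E) me me0)//.
- by rewrite probability_setT mul1e.
- by move=> B mB; rewrite setTI probability_setT mul1e.
- by apply: measurableT_comp => //; exact/measurable_EFinP.
Qed.

Lemma integrable_caratheodory (D : set T) (Y : T -> R) : measurable D ->
  measurable_fun [set: T] Y -> (forall w, a <= Y w <= b) ->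
  P.-integrable D (EFin \o (fun w => f (Y w) (e w))).
Proof.
move=> mD mY Yab.
apply: (@integrableS _ _ _ _ setT) => //.
apply: le_integrable (integrable_identically_distributed mS iS) => //.
  by apply/measurable_EFinP; exact: (measurable_caratheodory cf).
by move=> w _ /=; rewrite lee_fin (le_trans (fS _ _))// ler_norm.
Qed.

Lemma integrable_section t : a <= t <= b ->
  P.-integrable [set: T] (EFin \o (f t \o e0)).
Proof.
move=> tab; apply: le_integrable iS => //.
  by apply/measurable_EFinP; apply: measurableT_comp => //; exact: cf.1.
by move=> w _ /=; rewrite lee_fin (le_trans (fS _ _))// ler_norm.
Qed.

Lemma mean_caratheodory : caratheodory a b setT (fun t _ => g t).
Proof.
split=> [t tab|x u t _ uab tab ut]; first exact: measurable_cst.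
apply: (dominated_cvg_Rintegral (g := S \o e0)) => //.
- by move=> n; apply: measurableT_comp => //; exact: cf.1.
- by move=> w _; exact: cf.2.
- by move=> n w _; exact: fS.
Qed.

Lemma mean_le t : a <= t <= b -> `|g t| <= \int[P]_w S (e0 w).
Proof.
move=> tab; have ift := integrable_section tab.
apply: le_trans (le_normr_Rintegral _ ift) _ => //.
apply: le_Rintegral => //.
- exact: integrable_norm.
- by move=> w _; exact: fS.
Qed.

Lemma integrable_mean (D : set T) (Y : T -> R) : measurable D ->
  measurable_fun [set: T] Y -> (forall w, a <= Y w <= b) ->
  P.-integrable D (EFin \o (fun w => g (Y w))).
Proof.
move=> mD mY Yab; apply: (@integrableS _ _ _ _ setT) => //.
apply: le_integrable
  (finite_measure_integrable_cst P (\int[P]_w S (e0 w)) measurableT) => //.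
  apply/measurable_EFinP.
  exact: (measurable_caratheodory mean_caratheodory mY me).
by move=> w _ /=; rewrite lee_fin (le_trans (mean_le _))// ler_norm.
Qed.

Variable G : set (set T).
Hypotheses (mG : <<s G >> `<=` measurable)
  (iG : forall A, <<s G >> A -> indep_event P e A).

Let measurable_ofG (h : T -> R) :
  measurable_fun [set: g_sigma_algebraType G] h -> measurable_fun [set: T] h.
Proof. by move=> mh _ B mB; apply: mG; exact: mh. Qed.

(** Induction on the list of values of [h] on [A]: the slice where [h] equals the head is an event
    of the past, on which the parameter is constant and independence applies; the rest of [A] has a
    shorter list. *)
Lemma integral_freezing_simple (h : T -> R) (s : seq R) (A : set T) :
  measurable_fun [set: g_sigma_algebraType G] h -> <<s G >> A ->
  (forall w, a <= h w <= b) -> (forall w, A w -> h w \in s) ->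
  \int[P]_(w in A) f (h w) (e w) = \int[P]_(w in A) g (h w).
Proof.
move=> mh + hab; elim: s A => [|x s IH] A GA hs.
  have -> : A = set0 by rewrite -subset0 => w /hs.
  by rewrite !Rintegral_set0.
pose Ax := A `&` h @^-1` [set x]; pose A' := A `&` ~` (h @^-1` [set x]).
have Gx : <<s G >> (h @^-1` [set x]).
  by have := mh measurableT [set x] (measurable_set1 x); rewrite setTI.
have GAx : <<s G >> Ax.
  exact: (@measurableI _ (g_sigma_algebraType G)).
have GA' : <<s G >> A'.
  apply: (@measurableI _ (g_sigma_algebraType G)) => //.
  exact: (@measurableC _ (g_sigma_algebraType G)).
have AE : A = Ax `|` A' by rewrite -setIUr setUv setIT.
have dA : [disjoint Ax & A'].
  by apply/disj_setPS => w [[_ ?] [_]].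
have mh' := measurable_ofG mh.
rewrite AE !Rintegral_setU//; try exact: mG; last 2 first.
- by apply: integrable_mean => //; apply: measurableU; exact: mG.
- by apply: integrable_caratheodory => //; apply: measurableU; exact: mG.
congr (_ + _); last first.
  apply: IH => // w [Aw /eqP hx]; have := hs _ Aw.
  by rewrite inE (negbTE hx).
rewrite (@eq_Rintegral _ _ _ _ Ax (fun w => f x (e w))); last first.
  by move=> w; rewrite inE => -[_ /= ->].
rewrite [RHS](@eq_Rintegral _ _ _ _ Ax (fun w => g x)); last first.
  by move=> w; rewrite inE => -[_ /= ->].
rewrite Rintegral_cst; last exact: mG.
(* A listed value that is never attained on [A] may lie outside [[a, b]]; its slice is empty and
   both sides vanish. *)
have [[w [_ /= hwx]]|/forallNP Ax0] := pselect (exists w, Ax w); last first.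
  have -> : Ax = set0 by rewrite -subset0 => w /Ax0.
  by rewrite Rintegral_set0 measure0 mulr0.
have xab : a <= x <= b by rewrite -hwx.
by rewrite (integral_indep_event me me0 (mG GAx) (iG GAx) ee0 (cf.1 _ xab)
  (integrable_section xab)) mulrC.
Qed.

(* Replaces conditioning on the past: the past value [Y] is treated as a constant
   while the independent variable [e] is averaged out. *)
Lemma integral_freezing (Y : T -> R) (A : set T) :
  measurable_fun [set: g_sigma_algebraType G] Y -> <<s G >> A ->
  (forall w, a <= Y w <= b) ->
  \int[P]_(w in A) f (Y w) (e w) = \int[P]_(w in A) g (Y w).
Proof.
move=> mY GA Yab.
have [h [mh hab hs hY]] := simple_approximation mY Yab.
have mA := mG GA.
have lhs : \int[P]_(w in A) f (h n w) (e w) @[n --> \oo] -->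
    \int[P]_(w in A) f (Y w) (e w).
  apply: (dominated_cvg_Rintegral (g := S \o e)) => //.
  - move=> n; apply: measurable_funTS.
    exact: (measurable_caratheodory cf (measurable_ofG (mh n)) me).
  - by move=> w _; apply: cf.2.
  - apply: (@integrableS _ _ _ _ setT) => //.
    exact: integrable_identically_distributed.
  - by move=> n w _; exact: fS.
have rhs : \int[P]_(w in A) g (h n w) @[n --> \oo] -->
    \int[P]_(w in A) g (Y w).
  apply: (dominated_cvg_Rintegral (g := cst (\int[P]_w S (e0 w)))) => //.
  - move=> n; apply: measurable_funTS.
    exact: (measurable_caratheodory mean_caratheodory (measurable_ofG (mh n)) me).
  - by move=> w _; exact: (mean_caratheodory.2 0).
  - exact: finite_measure_integrable_cst.
  - by move=> n w _; exact: mean_le.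
have E : (fun n => \int[P]_(w in A) f (h n w) (e w)) =
    (fun n => \int[P]_(w in A) g (h n w)).
  apply/funext => n; have [s hns] := hs n.
  exact: (integral_freezing_simple (mh n) GA (hab n) (fun w _ => hns w)).
by rewrite E in lhs; exact: (cvg_unique (@norm_hausdorff _ _) lhs rhs).
Qed.

End freezing.

(** * The past of a sequence of independent variables *)

Section history.
Context {d : measure_display} {T : measurableType d} {R : realType}.
Variables (P : probability T R) (eps_ : nat -> {RV P >-> R}).

(** A pi-system generating the sigma-algebra of the noises of index at most [n], suited to the
    uniqueness theorem for measures. *)
Definition cylinders (n : nat) : set (set T) :=
  [set A | exists B : nat -> set R, (forall j, measurable (B j)) /\
    A = \bigcap_(j in [set j | (j <= n)%N]) (eps_ j @^-1` B j)].

Definition history (n : nat) := g_sigma_algebraType (cylinders n).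

Let measurable_preimage j (B : set R) :
  measurable B -> measurable (eps_ j @^-1` B).
Proof.
by move=> mB; rewrite -[X in measurable X]setTI; exact: measurable_funPT.
Qed.

Lemma history_measurable n : <<s cylinders n >> `<=` @measurable _ T.
Proof.
apply: smallest_sub; first exact: sigma_algebra_measurable.
move=> _ [B [mB ->]]; apply: fin_bigcap_measurable; first exact: (finite_II n.+1).
by move=> j _; exact: measurable_preimage.
Qed.

Lemma measurable_history_fun n (h : T -> R) :
  measurable_fun [set: history n] h -> measurable_fun [set: T] h.
Proof. by move=> mh _ B mB; apply: (@history_measurable n); exact: mh. Qed.

Lemma history_succ n : <<s cylinders n >> `<=` <<s cylinders n.+1 >>.
Proof.
apply: smallest_sub; first exact: smallest_sigma_algebra.
move=> _ [B [mB ->]]; apply: sub_sigma_algebra.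
exists (fun j => if (j <= n)%N then B j else setT); split.
  by move=> j; case: ifP.
apply/seteqP; split=> w h j /= jn; first by case: ifPn => // ?; exact: h.
by have := h j (leqW jn); rewrite jn.
Qed.

Lemma measurable_history_succ n (h : T -> R) :
  measurable_fun [set: history n] h -> measurable_fun [set: history n.+1] h.
Proof. by move=> mh _ B mB; apply: history_succ; exact: mh. Qed.

Lemma measurable_history n : measurable_fun [set: history n] (eps_ n).
Proof.
move=> _ B mB; rewrite setTI; apply: sub_sigma_algebra.
exists (fun j => if j == n then B else setT); split.
  by move=> j; case: ifP.
apply/seteqP; split=> w /= h.
  by move=> j _; case: ifPn => // /eqP ->.
by have := h n (leqnn n); rewrite eqxx.
Qed.

(** With [B] fixed, intersecting with the event on the new noise and scaling by its probability give
    two finite measures. They agree on the pi-system of cylinders and on the whole space, hence on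
    the past. *)
Lemma history_indep n A : independent_rvs eps_ ->
  <<s cylinders n >> A -> indep_event P (eps_ n.+1) A.
Proof.
move=> ind sA B mB.
have mE := measurable_preimage n.+1 mB.
have PE0 : 0 <= fine (P (eps_ n.+1 @^-1` B)) by rewrite fine_ge0.
pose H := [set X : set T | cylinders n X /\ X `<=` setT].
have HE : H = cylinders n by apply/seteqP; split => X; [case|split].
have := @g_sigma_algebra_measure_unique_trace _ R T (cylinders n) setT.
rewrite -/H HE => /(_ measurableT _ _ (mrestr P mE) (mscale (NngNum PE0) P)) /=.
rewrite /mrestr /mscale /= fineK ?fin_num_measure// => muniq.
rewrite muleC muniq//.
- by move=> X cX; apply: (@history_measurable n); exact: sub_sigma_algebra.
- move=> _ _ [B1 [mB1 ->]] [B2 [mB2 ->]].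
  exists (fun j => B1 j `&` B2 j); split.
    by move=> j; exact: measurableI.
  by rewrite -bigcapI; apply: eq_bigcapr => j _; rewrite preimage_setI.
- by rewrite setTI probability_setT mule1.
- move=> _ [C [mC ->]].
  (* The cylinder is extended by [B] at index [n.+1], so that independence of the indices 0 to
     [n.+1] gives the product formula. *)
  pose C' j := if (j <= n)%N then C j else B.
  have mC' j : measurable (C' j) by rewrite /C'; case: ifP.
  have C'n : C' n.+1 = B by rewrite /C' ltnn.
  have iotaS : iota 0 n.+2 = rcons (iota 0 n.+1) n.+1.
    by rewrite -cats1 -(addn1 n.+1) iotaD.
  have C'E j : j \in iota 0 n.+1 -> C' j = C j.
    by rewrite mem_iota add0n /= ltnS /C' => ->.
  have cylE m : [set j | (j <= m)%N] = [set` iota 0 m.+1].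
    by apply/seteqP; split => j; rewrite /mkset mem_iota.
  rewrite cylE; have := ind (iota 0 n.+2) C' (iota_uniq _ _) mC'.
  rewrite iotaS big_rcons /= C'n.
  have -> : \bigcap_(j in [set` rcons (iota 0 n.+1) n.+1]) (eps_ j @^-1` C' j) =
      \bigcap_(j in [set` iota 0 n.+1]) (eps_ j @^-1` C j) `&` eps_ n.+1 @^-1` B.
    rewrite -iotaS -!cylE; apply/seteqP; split=> w.
      move=> h; split; last by have := h n.+1 (leqnn _); rewrite C'n.
      by move=> j /= jn; have := h j (leqW jn); rewrite /C' jn.
    move=> [h1 h2] j /=; rewrite leq_eqVlt => /orP[/eqP ->|]; first by rewrite C'n.
    by rewrite ltnS => jn; rewrite /C' jn; exact: h1.
  move=> ->; rewrite [RHS]muleC.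
  have -> : P (\bigcap_(j in [set` iota 0 n.+1]) (eps_ j @^-1` C j)) =
      (\prod_(j <- iota 0 n.+1) P (eps_ j @^-1` C' j))%E.
    rewrite ind// ?iota_uniq// big_seq [RHS]big_seq.
    by apply: eq_bigr => j jn; rewrite C'E.
  by [].
- by rewrite setTI -ge0_fin_numE// fin_num_measure.
Qed.

End history.

(** * Robbins-Monro recursion *)

Section step_sizes.
Context {R : realType}.

(** If [v] stayed above [e], the comparison with [delta = e / 2] would keep [G] above
    [eta = e / (2 * K)]. Summing the recursion would then make [v] negative, since the sum of [c]
    diverges while that of its squares stays bounded. *)
Lemma recursion_frequently_small (v G c : nat -> R) (C : R) :
  (forall n, 0 <= v n) -> 0 <= C -> (forall n, 0 < c n) ->
  (forall n, v n.+1 <= v n - 2 * c n * G n + c n ^+ 2 * C) ->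
  (forall delta : R, 0 < delta ->
    exists2 K : R, 0 < K & forall n, v n <= delta + K * G n) ->
  (forall N (A : R), exists m, A < \sum_(N <= k < m) c k) ->
  (forall e : R, 0 < e -> exists N, forall n m, (N <= n)%N ->
    \sum_(n <= k < m) c k ^+ 2 <= e) ->
  forall N (e : R), 0 < e -> exists2 n, (N <= n)%N & v n < e.
Proof.
move=> v0 C0 c0 vS vG cdiv csq N e e0; apply: contrapT => /forall2NP small.
have ve n : (N <= n)%N -> e <= v n.
  by move=> Nn; case: (small n) => // /negP; rewrite -leNgt.
have [K K0 vK] := vG (e / 2) ltac:(lra).
(* Beyond [N1] the sums of squares are at most 1, so the error terms contribute at most [C]. *)
have [N1 sq] := csq 1 ltr01.
pose M := maxn N N1; pose eta := e / (2 * K).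
have eta0 : 0 < eta by rewrite divr_gt0// mulr_gt0.
have etaG n : (M <= n)%N -> eta <= G n.
  rewrite geq_max => /andP[Nn _].
  rewrite ler_pdivrMr ?mulr_gt0//; have := ve _ Nn; have := vK n.
  by nra.
have tele k : v (M + k)%N <= v M - 2 * eta * (\sum_(M <= i < M + k) c i) +
    C * \sum_(M <= i < M + k) c i ^+ 2.
  elim: k => [|k IH]; first by rewrite addn0 !big_geq//; lra.
  rewrite addnS !big_nat_recr ?leq_addr//=.
  have := vS (M + k)%N; have := etaG (M + k)%N (leq_addr _ _).
  have := c0 (M + k)%N; move: IH.
  move: (\sum_(_ <= _ < _) _) => s; move: (\sum_(_ <= _ < _) _) => t.
  nra.
(* Past this threshold the bound [tele] is negative. *)
have [m] := cdiv M ((v M + C) / (2 * eta)).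
have [mM|/ltnW Mm] := leqP m M.
  rewrite big_geq// ltNge divr_ge0// ?addr_ge0// mulr_ge0//; exact: ltW.
have eta2 : 0 < 2 * eta by rewrite pmulr_rgt0.
rewrite -(subnKC Mm) ltr_pdivrMr//.
have := tele (m - M)%N; have := sq M (M + (m - M))%N (leq_maxr _ _).
have := v0 (M + (m - M))%N.
move: (\sum_(_ <= _ < _) _) => s; move: (\sum_(_ <= _ < _) _) => t.
nra.
Qed.

(** In this form the projection inherits measurability and continuity from [max] and [min]. *)
Lemma proj_maxmin (a b x : R) : a <= b -> Defs.proj a b x = Num.max a (Num.min b x).
Proof.
move=> ab; rewrite /Defs.proj; case: (leP x a) => xa.
  by rewrite (min_idPr _) ?(le_trans xa)// max_l.
by case: (leP b x) => bx; rewrite max_r// ltW.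
Qed.

Lemma proj_itv (a b x : R) : a <= b -> a <= Defs.proj a b x <= b.
Proof.
move=> ab; rewrite /Defs.proj; case: (leP x a) => xa; first by rewrite lexx.
by case: (leP b x) => bx; rewrite ?ab ?lexx// !ltW.
Qed.

Lemma proj_contract (a b theta x : R) : a <= theta <= b ->
  (Defs.proj a b x - theta) ^+ 2 <= (x - theta) ^+ 2.
Proof.
move=> /andP[at_ tb]; rewrite /Defs.proj; case: (leP x a) => xa; first by nra.
by case: (leP b x) => bx; nra.
Qed.

End step_sizes.

Lemma measurable_lt_level {d} {T : measurableType d} {R : realType} (h : T -> R)
  (r : R) : measurable_fun [set: T] h -> measurable [set w | h w < r].
Proof.
move=> mh; have := mh measurableT _ (measurable_itv `]-oo, r[).
by rewrite setTI; congr (measurable _); apply/seteqP; split=> w; rewrite /= in_itv.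
Qed.

Lemma measurable_ge_level {d} {T : measurableType d} {R : realType} (h : T -> R)
  (r : R) : measurable_fun [set: T] h -> measurable [set w | r <= h w].
Proof.
move=> mh; have := mh measurableT _ (measurable_itv `[r, +oo[).
rewrite setTI; congr (measurable _).
by apply/seteqP; split=> w; rewrite /= in_itv/= andbT.
Qed.

(** Markov's inequality that keeps the integral below the level, so that it can be iterated in the
    maximal inequality. *)
Lemma truncation_le_Rintegral {d} {T : measurableType d} {R : realType}
    (P : probability T R) (A : set T) (W : T -> R) (lambda : R) :
  measurable A -> measurable_fun [set: T] W -> P.-integrable A (EFin \o W) ->
  lambda * fine (P (A `&` [set w | lambda <= W w])) +
    \int[P]_(w in A `&` [set w | W w < lambda]) W w <= \int[P]_(w in A) W w.
Proof.
move=> mA mW iW.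
have mge : measurable [set w | lambda <= W w].
  exact: measurable_ge_level.
have mlt : measurable [set w | W w < lambda].
  exact: measurable_lt_level.
have AE : A = (A `&` [set w | lambda <= W w]) `|` (A `&` [set w | W w < lambda]).
  rewrite -setIUr; apply/seteqP; split => w; last by case.
  by move=> Aw; split => //=; case: leP => _; [left|right].
have mAge := measurableI _ _ mA mge.
have mAlt := measurableI _ _ mA mlt.
rewrite [in leRHS]AE Rintegral_setU//; last 2 first.
- by rewrite -AE.
- by apply/disj_setPS => w [[_ /= h1] [_ /=]]; rewrite ltNge h1.
rewrite lerD2r -Rintegral_cst//; apply: le_Rintegral => //.
- exact: finite_measure_integrable_cst.
- exact: integrableS iW.
- by move=> w [].
Qed.

(** * Almost sure convergence of a projected recursion with increment [f] dominated by [S] *)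

Section robbins_monro.
Context {d : measure_display} {T : measurableType d} {R : realType}.
Variables (P : probability T R) (eps_ : nat -> {RV P >-> R}) (eps : {RV P >-> R}).
Variables (a b theta theta0 : R) (c : nat -> R) (J : set R).
Variables (f : R -> R -> R) (S : R -> R) (Y : nat -> T -> R).
Hypothesis eps_indep : independent_rvs eps_.
Hypothesis eps_id : forall n, same_distribution (eps_ n) eps.
Hypotheses (eps_J : forall n w, J (eps_ n w)) (epsJ : forall w, J (eps w)).
Hypotheses (cf : caratheodory a b J f) (mS : measurable_fun [set: R] S).
Hypothesis iS2 : P.-integrable [set: T] (EFin \o (fun w => S (eps w) ^+ 2)).
Hypothesis fS : forall t x, a <= t <= b -> J x -> `|f t x| <= S x.
Hypotheses (theta_ab : a < theta < b) (theta0_ab : a <= theta0 <= b).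

Hypothesis mean_sign : forall t, a <= t <= b -> t != theta ->
  0 < (t - theta) * \int[P]_w f t (eps w).
Hypothesis c_gt0 : forall n, 0 < c n.
Hypothesis c_sum : forall N (A : R), exists m, A < \sum_(N <= k < m) c k.
Hypothesis c_sum2 : forall e : R, 0 < e -> exists N, forall n m, (N <= n)%N ->
  \sum_(n <= k < m) c k ^+ 2 <= e.
Hypothesis Y0 : forall w, Y 0%N w = theta0.
Hypothesis YS : forall n w, Y n.+1 w =
  Defs.proj a b (Y n w - c n * f (Y n w) (eps_ n.+1 w)).

Let g (t : R) : R := \int[P]_w f t (eps w).

Let ab : a <= b. Proof. by case/andP: theta_ab => *; lra. Qed.
Let theta_ab' : a <= theta <= b.
Proof. by case/andP: theta_ab => *; lra. Qed.

Let Y_ab n w : a <= Y n w <= b.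
Proof. by case: n => [|n]; rewrite ?Y0// YS proj_itv. Qed.

Let ee0 n B : measurable B -> P (eps_ n @^-1` B) = P (eps @^-1` B).
Proof. by move=> mB; exact: (eps_id n mB). Qed.

Let me n : measurable_fun [set: T] (eps_ n).
Proof. exact: measurable_funPT. Qed.

Let me0 : measurable_fun [set: T] eps.
Proof. exact: measurable_funPT. Qed.

(** Adaptedness: the estimate at time [n] is a function of the noises up to [n], hence can be frozen
    against the noise of index [n.+1]. *)
Let hY n : measurable_fun [set: history eps_ n] (Y n).
Proof.
elim: n => [|n IH]; first by rewrite (funext Y0); exact: measurable_cst.
rewrite (funext (YS n)).
under eq_fun do rewrite proj_maxmin//.
apply: measurable_maxr; first exact: measurable_cst.
apply: measurable_minr; first exact: measurable_cst.
have mYn := measurable_history_succ IH.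
apply: measurable_funB => //; apply: measurable_funM; first exact: measurable_cst.
apply: (measurable_caratheodory cf mYn) => //.
exact: measurable_history.
Qed.

Let mY n : measurable_fun [set: T] (Y n).
Proof. exact: (measurable_history_fun (@hY n)). Qed.

Let V n w : R := (Y n w - theta) ^+ 2.
Let D := (b - a) ^+ 2.
Let G (t : R) : R := (t - theta) * g t.

Let mV n : measurable_fun [set: T] (V n).
Proof. by apply: measurable_funX; exact: measurable_funB. Qed.

Let V_ge0 n w : 0 <= V n w. Proof. exact: sqr_ge0. Qed.

Let V_le n w : V n w <= D.
Proof. by have := Y_ab n w; have := theta_ab'; rewrite /V /D; nra. Qed.

Let iV n A : measurable A -> P.-integrable A (EFin \o V n).
Proof.
move=> mA; apply: (@integrableS _ _ _ _ setT) => //.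
apply: le_integrable (finite_measure_integrable_cst P D measurableT) => //.
  exact/measurable_EFinP.
by move=> w _ /=; rewrite lee_fin !ger0_norm ?V_le// (le_trans (V_ge0 n w)).
Qed.

Let S_ge0 x : J x -> 0 <= S x.
Proof. by move=> Jx; exact: le_trans (normr_ge0 _) (fS theta_ab' Jx). Qed.

Let iS : P.-integrable [set: T] (EFin \o (S \o eps)).
Proof.
(* On a probability space the second moment controls the first, through [S <= 1 + S ^+ 2]. *)
have i1 : P.-integrable [set: T] (EFin \o (fun w => 1 + S (eps w) ^+ 2)).
  have := integrableD measurableT
    (finite_measure_integrable_cst P 1 measurableT) iS2.
  by apply: eq_integrable.
apply: le_integrable i1 => //.
  by apply/measurable_EFinP; exact: measurableT_comp.
move=> w _ /=; rewrite lee_fin !ger0_norm ?addr_ge0 ?sqr_ge0 ?S_ge0//.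
by have := S_ge0 (epsJ w); nra.
Qed.

(** The cross term in the expansion of the squared distance to [theta] after one step; its frozen
    mean is [G]. *)
Let f1 (t x : R) : R := (t - theta) * f t x.
Let S1 x := (b - a) * S x.

Let cf1 : caratheodory a b J f1.
Proof.
split=> [t tab|x u t Jx uab tab ut].
  by apply: measurable_funM; [exact: measurable_cst|exact: cf.1].
apply: cvgM; last exact: cf.2.
by apply: cvgB => //; exact: cvg_cst.
Qed.

Let mS1 : measurable_fun [set: R] S1.
Proof. by apply: measurable_funM => //; exact: measurable_cst. Qed.

Let iS1 : P.-integrable [set: T] (EFin \o (S1 \o eps)).
Proof.
have := integrableZl measurableT (b - a) iS.
by apply: eq_integrable.
Qed.

Let f1S1 t x : a <= t <= b -> J x -> `|f1 t x| <= S1 x.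
Proof.
move=> tab Jx; rewrite /f1 /S1 normrM ler_pM// ?fS//.
by rewrite ler_norml; have := theta_ab'; lra.
Qed.

Let GE t : a <= t <= b -> \int[P]_w f1 t (eps w) = G t.
Proof.
move=> tab; rewrite RintegralZl//.
exact: (integrable_section cf me0 epsJ iS fS tab).
Qed.

Let cG : caratheodory a b setT (fun t _ => G t).
Proof.
have [h1 h2] := mean_caratheodory cf1 me0 epsJ iS1 f1S1.
split=> [t tab|x u t _ uab tab ut]; first exact: measurable_cst.
have := h2 0 u t I uab tab ut; rewrite GE//.
by under eq_fun do rewrite GE//.
Qed.

Let G_ge0 t : a <= t <= b -> 0 <= G t.
Proof.
move=> tab; have [->|tt] := eqVneq t theta; first by rewrite /G subrr mul0r.
exact/ltW/mean_sign.
Qed.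

Let iG n A : measurable A -> P.-integrable A (EFin \o (fun w => G (Y n w))).
Proof.
move=> mA.
have := integrable_mean cf1 (@me n) me0 epsJ iS1 f1S1 mA (@mY n) (Y_ab n).
by apply: eq_integrable => // w _ /=; rewrite GE.
Qed.

Let C := \int[P]_w (S (eps w) ^+ 2).

Let C_ge0 : 0 <= C. Proof. by apply: Rintegral_ge0 => w _; exact: sqr_ge0. Qed.

Let fine_P_le1 A : measurable A -> fine (P A) <= 1.
Proof.
move=> mA; rewrite -[leRHS]/(fine 1%E) fine_le// ?fin_num_measure//.
exact: probability_le1.
Qed.

(* Almost-supermartingale property, with the conditional expectation replaced by
   integration over an arbitrary past event [A]. *)
Let step n A : <<s cylinders eps_ n >> A ->
  \int[P]_(w in A) V n.+1 w <=
  \int[P]_(w in A) V n w - 2 * c n * \int[P]_(w in A) G (Y n w) + c n ^+ 2 * C.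
Proof.
move=> sA; have mA := history_measurable sA.
have iA := history_indep eps_indep sA.
have i2 : P.-integrable A (EFin \o (fun w => S (eps_ n.+1 w) ^+ 2)).
  apply: (@integrableS _ _ _ _ setT) => //.
  apply: (integrable_identically_distributed (phi := fun x => S x ^+ 2)
    (@me n.+1) me0 (@ee0 n.+1) _ iS2).
  exact: measurable_funX.
have if1 : P.-integrable A (EFin \o (fun w => f1 (Y n w) (eps_ n.+1 w))).
  exact: (integrable_caratheodory cf1 (@me n.+1) me0 (eps_J n.+1) (@ee0 n.+1)
    mS1 iS1 f1S1).
have iE (h : T -> R) (r : R) : P.-integrable A (EFin \o h) ->
    P.-integrable A (EFin \o (fun w => r * h w)).
  by move=> ih; have := integrableZl mA r ih; exact: eq_integrable.
have iV' := iV n mA.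
(* Freezing, read backwards, puts the actual noise into the drift, so that the inequality can be
   checked pointwise. *)
have -> : \int[P]_(w in A) G (Y n w) =
    \int[P]_(w in A) f1 (Y n w) (eps_ n.+1 w).
  rewrite (integral_freezing cf1 (@me n.+1) me0 (eps_J n.+1) epsJ (@ee0 n.+1)
    mS1 iS1 f1S1 (@history_measurable _ _ _ _ eps_ n)
    (fun B => @history_indep _ _ _ _ eps_ n B eps_indep) (@hY n) sA (Y_ab n)).
  by apply: eq_Rintegral => w _; rewrite GE.
have S2le : \int[P]_(w in A) (S (eps_ n.+1 w) ^+ 2) <= C.
  rewrite (integral_indep_event (phi := fun x => S x ^+ 2) (@me n.+1) me0 mA iA
    (@ee0 n.+1))//; last exact: measurable_funX.
  by rewrite ler_piMl// fine_P_le1.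
have iB : P.-integrable A
    (EFin \o (fun w => V n w - (2 * c n) * f1 (Y n w) (eps_ n.+1 w))).
  have := integrableB mA iV' (iE _ (2 * c n) if1).
  exact: eq_integrable.
apply: (@le_trans _ _ (\int[P]_(w in A)
   ((V n w - (2 * c n) * f1 (Y n w) (eps_ n.+1 w)) +
    c n ^+ 2 * S (eps_ n.+1 w) ^+ 2))).
  apply: le_Rintegral => //; first exact: iV.
    have := integrableD mA iB (iE _ (c n ^+ 2) i2).
    exact: eq_integrable.
  move=> w _; rewrite /V YS.
  (* The projection is dropped, and the square of the unprojected step is expanded. *)
  apply: le_trans (proj_contract _ theta_ab') _.
  have fs := fS (Y_ab n w) (eps_J n.+1 w).
  have f2 : f (Y n w) (eps_ n.+1 w) ^+ 2 <= S (eps_ n.+1 w) ^+ 2.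
    by rewrite -real_normK ?num_real// lerXn2r// nnegrE// S_ge0.
  have := ler_wpM2l (sqr_ge0 (c n)) f2.
  by rewrite /f1; lra.
rewrite RintegralD//; last exact: iE.
rewrite RintegralB//; last exact: iE.
rewrite !RintegralZl// lerD2l.
by rewrite ler_wpM2l// sqr_ge0.
Qed.

(** The function [h] below is continuous and positive on [[a, b]]: its first term is positive at
    [theta], its second elsewhere. Where the square exceeds [delta] the first term vanishes, so the
    minimum of [h] bounds [G] from below. *)
Let sq_le_G (delta : R) : 0 < delta -> exists2 K, 0 < K &
  forall t, a <= t <= b -> (t - theta) ^+ 2 <= delta + K * G t.
Proof.
move=> delta0.
pose h t : R := Num.max (delta - (t - theta) ^+ 2) 0 + G t.
(* Composition with the projection makes [h] continuous on the whole line, as [G] is controlled on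
   [[a, b]] only. *)
pose p t : R := Num.max a (Num.min b t).
have pab t : a <= p t <= b by rewrite /p -proj_maxmin// proj_itv.
have pid t : a <= t <= b -> p t = t.
  by move=> /andP[at_ tb]; rewrite /p min_r// max_r.
have cp : continuous p.
  move=> t; apply: continuous_max; first exact: cst_continuous.
  by apply: continuous_min; [exact: cst_continuous|].
have ch : continuous (h \o p).
  move=> t; apply/(@cvg_nbhsP _ R^o) => u ut.
  have put : p (u n) @[n --> \oo] --> p t.
    exact: (cvg_comp _ _ ut (cp t)).
  apply: cvgD; last by apply: (cG.2 0).
  have cq : continuous (fun s : R => Num.max (delta - (s - theta) ^+ 2) 0).
    move=> s; apply: (@continuous_max _ _ (fun s : R => delta - (s - theta) ^+ 2)
      (cst 0)); last exact: cst_continuous.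
    apply: cvgB; first exact: cvg_cst.
    by apply: cvgM; apply: cvgB => //; exact: cvg_cst.
  exact: (cvg_comp _ _ put (cq (p t))).
have [m mab hm] := EVT_min ab (continuous_subspaceT ch).
rewrite in_itv/= in mab.
have hm0 : 0 < h m.
  rewrite /h; have [->|mt] := eqVneq m theta.
    by rewrite subrr expr0n/= subr0 max_l ?ltW// ltr_pwDl// G_ge0.
  by rewrite ltr_wpDl ?le_max ?lexx ?orbT// mean_sign.
have h0 t : a <= t <= b -> h m <= h t.
  by move=> tab; have := hm t; rewrite in_itv/= tab !pid//; apply.
have D0 : 0 < D.
  by rewrite exprn_gt0// subr_gt0; case/andP: theta_ab; exact: lt_trans.
(* [D] bounds every squared distance to [theta] in the interval, and [G] is at least [h m] away from
   [theta]. *)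
exists (D / h m) => [|t tab]; first exact: divr_gt0.
have [le_d|gt_d] := leP ((t - theta) ^+ 2) delta.
  rewrite (le_trans le_d)// lerDl mulr_ge0// ?G_ge0//.
  by rewrite divr_ge0// ltW.
have hG : h m <= G t.
  by rewrite (le_trans (h0 _ tab))// /h max_r ?add0r// subr_le0 ltW.
apply: (@le_trans _ _ D).
  by have := theta_ab'; rewrite /D; nra.
apply: (@le_trans _ _ (D / h m * G t)); last by rewrite lerDr ltW.
by rewrite mulrAC ler_pdivlMr// ler_wpM2l// ltW.
Qed.

Let v n := \int[P]_w V n w.

Let v_small N (e : R) : 0 < e -> exists2 n, (N <= n)%N & v n < e.
Proof.
apply: (@recursion_frequently_small _ v (fun n => \int[P]_w G (Y n w)) c C) => //.
- by move=> n; apply: Rintegral_ge0 => w _; exact: V_ge0.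
- move=> n; apply: step.
  exact: (@measurableT _ (history eps_ n)).
- move=> delta /sq_le_G[K K0 VK]; exists K => // n.
  have i1 := finite_measure_integrable_cst P delta measurableT.
  have i2 : P.-integrable setT (EFin \o (fun w => K * G (Y n w))).
    by have := integrableZl measurableT K (iG n measurableT); exact: eq_integrable.
  rewrite -RintegralZl//; last exact: iG.
  have -> : delta = \int[P]_(w in setT) delta.
    rewrite Rintegral_cst//.
    rewrite -[LHS]mulr1; congr (_ * _).
    by rewrite -[LHS]/(fine 1%E) -(probability_setT P).
  rewrite -RintegralD//.
  apply: le_Rintegral => //; first exact: iV.
    by have := integrableD measurableT i1 i2; exact: eq_integrable.
  by move=> w _; exact: VK.
Qed.

(** The event that [V] has not yet reached [lambda]. It belongs to the past of [n + k], so [step]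
    applies on it. *)
Let below n k (lambda : R) : set T :=
  [set w | forall i, (i <= k)%N -> V (n + i)%N w < lambda].

Let belowS n k lambda : below n k.+1 lambda =
  below n k lambda `&` [set w | V (n + k.+1)%N w < lambda].
Proof.
apply/seteqP; split=> [w h|w [h1 h2] i].
  by split; [move=> i ik; exact: h (leqW ik)|exact: h].
by rewrite leq_eqVlt => /orP[/eqP -> //|]; exact: h1.
Qed.

Let hV n lambda : <<s cylinders eps_ n >> [set w | V n w < lambda].
Proof.
have mVn : measurable_fun [set: history eps_ n] (V n).
  by apply: measurable_funX; apply: measurable_funB => //; exact: hY.
exact: (@measurable_lt_level _ (history eps_ n) _ _ lambda mVn).
Qed.

Let h_below n k lambda : <<s cylinders eps_ (n + k) >> (below n k lambda).
Proof.
elim: k => [|k IH].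
  rewrite (_ : below n 0 lambda = [set w | V (n + 0)%N w < lambda]); first exact: hV.
  apply/seteqP; split=> w h; first exact: h.
  by move=> i; rewrite leqn0 => /eqP ->.
rewrite belowS; apply: (@measurableI _ (history eps_ (n + k.+1))); last exact: hV.
by rewrite addnS; exact: history_succ.
Qed.

Let m_below n k lambda : measurable (below n k lambda).
Proof. exact: (history_measurable (@h_below n k lambda)). Qed.

(* Doob's maximal inequality: stop [V] when it first exceeds [lambda]. *)
Let maximal n k (lambda : R) :
  lambda * fine (P (~` below n k lambda)) +
    \int[P]_(w in below n k lambda) V (n + k)%N w <=
  v n + C * \sum_(n <= i < n + k) c i ^+ 2.
Proof.
elim: k => [|k IH].
  rewrite addn0 big_geq// mulr0 addr0.
  have b0 : below n 0 lambda = setT `&` [set w | V n w < lambda].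
    rewrite setTI; apply/seteqP; split=> w h.
      by have := h 0%N; rewrite addn0; apply.
    by move=> i; rewrite leqn0 => /eqP ->; rewrite addn0.
  have b0C : ~` below n 0 lambda = setT `&` [set w | lambda <= V n w].
    rewrite b0 !setTI; apply/seteqP; split=> w /=; last by rewrite leNgt => /negP.
    by move=> /negP; rewrite -leNgt.
  rewrite b0C b0; apply: truncation_le_Rintegral => //; exact: iV.
have mB := m_below n k lambda.
have trunc := @truncation_le_Rintegral _ _ _ P (below n k lambda)
  (V (n + k).+1) lambda mB (@mV _) (iV _ mB).
have stp := step (@h_below n k lambda).
have G0 : 0 <= \int[P]_(w in below n k lambda) G (Y (n + k) w).
  by apply: Rintegral_ge0 => w _; exact: G_ge0.
(* The drift term is nonnegative and can be discarded. *)
have cG0 := mulr_ge0 (mulr_ge0 (ler0n R 2) (ltW (c_gt0 (n + k)))) G0.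
have mge : measurable [set w | lambda <= V (n + k).+1 w].
  exact: measurable_ge_level.
(* Either the level is reached by time [n + k], or it is reached for the first time at
   [(n + k).+1]. *)
have PE : fine (P (~` below n k.+1 lambda)) = fine (P (~` below n k lambda)) +
    fine (P (below n k lambda `&` [set w | lambda <= V (n + k).+1 w])).
  rewrite -fineD ?fin_num_measure//; [|exact: measurableC|exact: measurableI].
  rewrite -measureU//; [|exact: measurableC|exact: measurableI|].
    congr (fine (P _)); rewrite belowS addnS setCI; apply/seteqP; split=> w /=.
      have [bw|] := pselect (below n k lambda w); last by left.
      by case=> // /negP; rewrite -leNgt; right.
    by case=> [|[_ h]]; [left|right; rewrite ltNge h].
  by apply/seteqP; split=> w // [/= ? []].
rewrite PE belowS addnS big_nat_recr ?leq_addr//=.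
by lra.
Qed.

(** At a late [n], both the mean of [V n] and the remaining error are at most [lambda * e / 2]. The
    maximal inequality bounds the probability of reaching [lambda] within any finite horizon by [e],
    and the horizon is then sent to infinity. *)
Let tail_small (lambda e : R) : 0 < lambda -> 0 < e -> exists n,
  (P (\bigcup_(j >= n) [set w | (lambda <= V j w)%R]) <= e%:E)%E.
Proof.
move=> lambda0 e0.
have CP : 0 < C + 1 by rewrite ltr_wpDl.
have le0 : 0 < lambda * e / 2 by rewrite divr_gt0// mulr_gt0.
(* Dividing by [C + 1] rather than [C], which may be zero. *)
have [N sq] := c_sum2 (divr_gt0 le0 CP).
have [n Nn vn] := v_small N le0.
exists n.
have bound k : (P (~` below n k lambda) <= e%:E)%E.
  have PfE : P (~` below n k lambda) \is a fin_num.
    by rewrite fin_num_measure//; exact: measurableC.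
  rewrite -(fineK PfE) lee_fin -(ler_pM2l lambda0).
  have I0 : 0 <= \int[P]_(w in below n k lambda) V (n + k)%N w.
    by apply: Rintegral_ge0 => w _; exact: V_ge0.
  have Csq : C * \sum_(n <= i < n + k) c i ^+ 2 <= lambda * e / 2.
    have := sq n (n + k)%N Nn; rewrite ler_pdivlMr// => h.
    apply: le_trans h; rewrite mulrC ler_wpM2l ?lerDl//.
    by apply: sumr_ge0 => i _; exact: sqr_ge0.
  by have := maximal n k lambda; lra.
have -> : \bigcup_(j >= n) [set w | lambda <= V j w] =
    \bigcup_k ~` below n k lambda.
  apply/seteqP; split=> w [j].
    move=> /= nj Vj; exists (j - n)%N => //= h.
    by have := h _ (leqnn _); rewrite subnKC// ltNge Vj.
  move=> _ /= /existsNP[i /not_implyP[ij /negP]]; rewrite -leNgt => Vi.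
  by exists (n + i)%N => //=; exact: leq_addr.
have mC k : measurable (~` below n k lambda) by exact: measurableC.
have nd : nondecreasing_seq (fun k => ~` below n k lambda).
  move=> k k' kk'; apply/subsetPset; apply: subsetC => w h i ik.
  exact: h (leq_trans ik kk').
(* Continuity of [P] along the increasing events that the level is reached by time [n + k]. *)
have cv := @nondecreasing_cvg_mu _ _ _ P _ mC (bigcup_measurable (fun k _ => mC k)) nd.
rewrite -(cvg_lim _ cv)//; apply: lime_le; first by apply/cvg_ex; eexists; exact: cv.
by apply: nearW => k; exact: bound.
Qed.

(** Failure of convergence means that [V] exceeds some [k.+1%:R^-1] infinitely often. Each such
    upper limit lies in every tail union, hence is null by [tail_small]. *)
Lemma robbins_monro_cvg : {ae P, forall w, Y n w @[n --> \oo] --> theta}.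
Proof.
pose F k j := [set w | k.+1%:R^-1 <= V j w].
have mF k j : measurable (F k j).
  exact: measurable_ge_level.
have Fnull k : P.-negligible (lim_sup_set (F k)).
  exists (lim_sup_set (F k)); split => //.
    apply: bigcap_measurable => // n _; exact: bigcup_measurable.
  apply/eqP; rewrite eq_le measure_ge0 andbT; apply/lee_addgt0Pr => e e0.
  rewrite add0e; have [|n hn] := @tail_small k.+1%:R^-1 e _ e0.
    by rewrite invr_gt0.
  exact: le_trans (lim_sup_set_ub _ _ (mF k)) hn.
apply: negligibleS (negligible_bigcup Fnull) => w /=; apply: contra_notP => /= h.
apply/cvgrPdist_le => e e0.
have e2 : 0 < e ^+ 2 by rewrite exprn_gt0.
have [k] : exists k, k.+1%:R^-1 < e ^+ 2.
  have := near_infty_natSinv_lt (PosNum e2).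
  by case=> k _ hk; exists k; exact: (hk k (leqnn k)).
move=> ke.
have : ~ lim_sup_set (F k) w by move=> hk; apply: h; exists k.
move=> /existsNP[n /not_implyP[_ hn]].
exists n => // j /= nj.
have Vj : V j w < k.+1%:R^-1.
  by rewrite ltNge; apply/negP => hj; apply: hn; exists j.
have : V j w <= e ^+ 2 by rewrite ltW// (lt_trans Vj).
rewrite /V -ler_sqrt// ?sqrtr_sqr ?sqr_ge0//.
by rewrite distrC (ger0_norm (ltW e0)).
Qed.

End robbins_monro.

(** * Borel extensions *)

Section borel_extensions.
Context {R : realType}.
Implicit Types (J : set R) (phi : R -> R).

(* [J] need not be measurable: [phi] agrees on [J] with a Borel function. *)
Definition borel_on J phi : Prop :=
  exists2 psi : R -> R, measurable_fun [set: R] psi & {in J, psi =1 phi}.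

(** The Borel extensions may fail to converge off [J]; their upper limit is measurable everywhere
    and is the limit on [J]. *)
Lemma borel_on_cvg J (F : nat -> R -> R) phi :
  (forall n, borel_on J (F n)) ->
  (forall x, J x -> F n x @[n --> \oo] --> phi x) -> borel_on J phi.
Proof.
move=> bF Fphi.
have /choice[G GF] : forall n, exists g : R -> R,
    measurable_fun [set: R] g /\ {in J, g =1 F n}.
  by move=> n; have [g] := bF n; exists g.
exists (fun x => fine (limn_esup (fun n => (G n x)%:E))).
  apply: (@measurableT_comp _ _ _ _ _ _ (@fine R)) => //.
  apply: (@measurable_fun_limn_esup _ _ _ setT (fun n x => (G n x)%:E)) => n.
  by apply/measurable_EFinP; exact: (GF n).1.
move=> x Jx.
have cG : (G n x)%:E @[n --> \oo] --> (phi x)%:E.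
  under eq_fun do rewrite (GF _).2//.
  by apply: cvg_EFin; [exact: nearW|apply: Fphi; rewrite inE in Jx].
by rewrite limn_esup_lim (cvg_lim _ (cvg_esups cG)).
Qed.

(** The extension takes the supremum of [phi] over the points of [J] to the left. It is monotone on
    the whole line, so preimages of rays are intervals; infinite values can occur only off [J]. *)
Lemma borel_on_nondecreasing J phi :
  (forall x y, J x -> J y -> x <= y -> phi x <= phi y) -> borel_on J phi.
Proof.
move=> incr.
pose K x : \bar R := ereal_sup [set (phi y)%:E | y in [set y | J y /\ y <= x]].
have K_le x y : x <= y -> (K x <= K y)%E.
  move=> xy; apply: ereal_sup_le => _ [z [Jz zx] <-].
  by exists z => //; split => //; exact: le_trans xy.
exists (fine \o K).
  apply: (@measurableT_comp _ _ _ _ _ _ (@fine R)) => //.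
  move=> mT; apply: (measurability _ (ErealGenOInfty.measurableE R)) => //.
  move=> _ [_ [r ->] <-]; rewrite setTI; apply: is_interval_measurable.
  move=> x y /=; rewrite !in_itv/= !andbT => xr _ z /andP[xz _].
  by rewrite in_itv/= andbT (lt_le_trans xr)// K_le.
move=> x /[!inE] Jx /=; suff -> : K x = (phi x)%:E by [].
apply/eqP; rewrite eq_le; apply/andP; split.
  by apply: ge_ereal_sup => _ [y [Jy yx] <-]; rewrite lee_fin; exact: incr.
by apply: ereal_sup_ubound; exists x.
Qed.

Lemma borel_onM J phi psi :
  borel_on J phi -> borel_on J psi -> borel_on J (fun x => phi x * psi x).
Proof.
move=> [F mF FE] [G mG GE]; exists (fun x => F x * G x).
  exact: measurable_funM.
by move=> x Jx; rewrite FE// GE.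
Qed.

Lemma borel_onB J phi psi :
  borel_on J phi -> borel_on J psi -> borel_on J (fun x => phi x - psi x).
Proof.
move=> [F mF FE] [G mG GE]; exists (fun x => F x - G x).
  exact: measurable_funB.
by move=> x Jx; rewrite FE// GE.
Qed.

Lemma borel_on_measurable J phi : measurable_fun [set: R] phi -> borel_on J phi.
Proof. by move=> mphi; exists phi. Qed.

Lemma borel_on_comp {d} {T : measurableType d} J phi (e : T -> R) :
  borel_on J phi -> measurable_fun [set: T] e -> (forall w, J (e w)) ->
  measurable_fun [set: T] (fun w => phi (e w)).
Proof.
move=> [psi mpsi psiE] me eJ.
rewrite (_ : (fun w => _) = psi \o e); first exact: measurableT_comp.
by apply/funext => w /=; rewrite psiE// inE.
Qed.

Lemma exists_dense_sequence (a b : R) : a <= b -> exists r : nat -> R,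
  (forall k, a <= r k <= b) /\
  forall t, a <= t <= b -> exists s : nat -> nat, r (s n) @[n --> \oo] --> t.
Proof.
(* An enumeration of the rationals, where codes of no rational give 0. Projecting onto [[a, b]] does
   not increase the distance to [t]. *)
move=> ab; pose q k : R := ratr (odflt 0 (unpickle k : option rat)).
exists (fun k => Defs.proj a b (q k)); split; first by move=> k; exact: proj_itv.
move=> t tab.
have near_t n : exists k, `|q k - t| < n.+1%:R^-1.
  have tt : t < t + n.+1%:R^-1 by rewrite ltrDl invr_gt0.
  have [p] := rat_in_itvoo tt.
  rewrite in_itv/= => /andP[tp pt]; exists (pickle p).
  rewrite /q pickleK/= ger0_norm ?subr_ge0 ?(ltW tp)//.
  by rewrite ltrBlDl.
have [s sP] := choice near_t.
exists s; apply/cvgrPdist_lt => e e0; near=> n.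
rewrite distrC; apply: (@le_lt_trans _ _ `|q (s n) - t|).
  rewrite -ler_sqr ?nnegrE// !real_normK ?num_real//.
  exact: proj_contract.
apply: lt_trans (sP n) _; near: n.
exact: (near_infty_natSinv_lt (PosNum e0)).
Unshelve. all: by end_near. Qed.

(* The supremum is attained by compactness and may be taken over a countable
   dense set, whence its measurability. *)
Lemma borel_sup_itv J (a b : R) (D : R -> R -> R) : a <= b ->
  (forall t, a <= t <= b -> borel_on J (D t)) ->
  (forall x, J x -> {within `[a, b], continuous (D ^~ x)}) ->
  exists S : R -> R, [/\ measurable_fun [set: R] S,
    forall t x, a <= t <= b -> J x -> `|D t x| <= S x &
    forall x, J x -> exists2 t, a <= t <= b & S x = `|D t x|].
Proof.
move=> ab bD cD.
have [r [rab rdense]] := exists_dense_sequence ab.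
have /choice[G GD] : forall k, exists g : R -> R,
    measurable_fun [set: R] g /\ {in J, g =1 D (r k)}.
  by move=> k; have [g] := bD _ (rab k); exists g.
(* At index 0, [esups] is the supremum of the whole sequence. *)
pose K x : \bar R := esups (fun k => `|G k x|%:E) 0.
have cabs x : J x -> {within `[a, b], continuous (fun t => `|D t x|)}.
  move=> Jx t; apply: continuous_comp; first exact: cD.
  exact: norm_continuous.
have max x : J x -> exists2 t, a <= t <= b & (forall s, a <= s <= b ->
    `|D s x| <= `|D t x|) /\ K x = `|D t x|%:E.
  move=> Jx; have [t tab tmax] := EVT_max ab (cabs x Jx).
  rewrite in_itv/= in tab; exists t => //.
  have tmax' s : a <= s <= b -> `|D s x| <= `|D t x|.
    by move=> sab; apply: tmax; rewrite in_itv.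
  split => //; have GE k : G k x = D (r k) x by rewrite (GD k).2// inE.
  apply/eqP; rewrite eq_le; apply/andP; split.
    apply: ge_ereal_sup => _ [k _ <-]; rewrite lee_fin GE.
    exact: tmax'.
  have [s st] := rdense _ tab.
  have cDt : D (r (s n)) x @[n --> \oo] --> D t x.
    have /subspace_continuousP/(_ t) := cD x Jx.
    rewrite /= in_itv/= tab => /(_ isT); apply: cvg_comp.
    move=> A [e /= e0 eA]; have /cvgrPdist_lt/(_ _ e0) := st.
    by apply: filterS => n /= h; apply: eA => //=; rewrite in_itv/=.
  have cDt' : `|D (r (s n)) x|%:E @[n --> \oo] --> `|D t x|%:E.
    by apply: cvg_EFin; [exact: nearW|exact: cvg_norm].
  rewrite -(cvg_lim _ cDt')//; apply: lime_le.
    by apply/cvg_ex; eexists; exact: cDt'.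
  apply: nearW => n; apply: ereal_sup_ubound; exists (s n) => //.
  by rewrite GE.
exists (fine \o K); split.
- apply: (@measurableT_comp _ _ _ _ _ _ (@fine R)) => //.
  apply: (@measurable_fun_esups _ _ _ setT (fun k x => `|G k x|%:E)) => k.
  by apply/measurable_EFinP; apply: measurableT_comp => //; exact: (GD k).1.
- by move=> t x tab /max[s _ [smax /= ->]]; exact: smax.
- by move=> x /max[s sab [_ /= ->]]; exists s.
Qed.

End borel_extensions.

(** * Derivatives relative to an interval *)

Section derivative_within.
Context {R : realType}.
Implicit Types (D : set R) (f : R -> R) (t l : R).

(** Sequences are needed for dominated convergence and for Borel limits. Conversely, a failure of
    the limit gives points within [n.+1%:R^-1] of [t] whose images stay at distance at least [e]. *)
Lemma cvg_dnbhs_withinP D f t l :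
  f s @[s --> within D t^'] --> l <->
  forall u : nat -> R, (forall n, D (u n) /\ u n != t) ->
    u n @[n --> \oo] --> t -> f (u n) @[n --> \oo] --> l.
Proof.
split=> [fl u Du ut|seq].
  apply: cvg_comp fl => A [e /= e0 eA]; move/cvgrPdist_lt : ut => /(_ _ e0).
  by apply: filterS => n /= h; apply: eA => //; case: (Du n).
apply/cvgrPdist_lt => e e0; apply: contrapT => far.
have /choice[u uP] : forall n, exists s : R,
    [/\ D s, s != t, `|t - s| < n.+1%:R^-1 & e <= `|l - f s|].
  move=> n; apply: contrapT => /forallNP h; apply: far.
  exists n.+1%:R^-1; first by rewrite /= invr_gt0.
  move=> s /= ts st Ds; rewrite ltNge; apply/negP => es.
  by apply: (h s).
have ut : u n @[n --> \oo] --> t.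
  apply/cvgrPdist_lt => r r0; near=> n.
  have [_ _ /lt_trans + _] := uP n; apply.
  near: n; exact: (near_infty_natSinv_lt (PosNum r0)).
have Du n : D (u n) /\ u n != t by have [] := uP n.
have /cvgrPdist_lt/(_ _ e0)[n _ /(_ n (leqnn n))] := seq u Du ut.
by rewrite /= ltNge; have [_ _ _ ->] := uP n.
Unshelve. all: by end_near. Qed.

(** This makes relative derivatives unique. Moving from [t] slightly towards another point of [D]
    stays in [D] by convexity. *)
Lemma within_dnbhs_proper D (x y t : R) : is_interval D -> D x -> D y ->
  x < y -> D t -> ProperFilter (within D t^').
Proof.
move=> itvD Dx Dy xy Dt; apply: Build_ProperFilter_ex => A [e /= e0 eA].
have [z [Dz zt]] : exists z, D z /\ z != t.
  by have [<-|xt] := eqVneq x t; [exists y|exists x]; rewrite // gt_eqF.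
pose k := Num.min 1 (e / 2 / `|z - t|).
have zt0 : 0 < `|z - t| by rewrite normr_gt0 subr_eq0.
have k0 : 0 < k by rewrite lt_min ltr01 !divr_gt0.
have k1 : k <= 1 by rewrite ge_min lexx.
exists (t + k * (z - t)); apply: eA.
- rewrite /ball/= opprD addNKr normrN normrM gtr0_norm//.
  apply: (@le_lt_trans _ _ (e / 2)); last first.
    by rewrite ltr_pdivrMr// mulr2n mulrDr mulr1 ltrDl.
  by rewrite -ler_pdivlMr// ge_min lexx orbT.
- rewrite -subr_eq0 addrAC subrr add0r mulf_neq0 ?(lt0r_neq0 k0)//.
  by rewrite subr_eq0.
- have [zt'|tz|/eqP] := ltgtP z t; last by rewrite (negbTE zt).
    by apply: (itvD _ _ Dz Dt); nra.
  by apply: (itvD _ _ Dt Dz); nra.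
Qed.

Lemma derive_within_cvg D f t : derivable_within D f t ->
  (f s - f t) / (s - t) @[s --> within D t^'] --> derive_within D f t.
Proof. by []. Qed.

Lemma continuous_within_seq D f t (u : nat -> R) :
  {within D, continuous f} -> D t -> (forall n, D (u n)) ->
  u n @[n --> \oo] --> t -> f (u n) @[n --> \oo] --> f t.
Proof.
move=> /subspace_continuousP/(_ t) + Dt Du ut => /(_ Dt); apply: cvg_comp.
move=> A [e /= e0 eA]; have /cvgrPdist_lt/(_ _ e0) := ut.
by apply: filterS => n /= h; exact: eA.
Qed.

Lemma derivable_within_continuous D f :
  (forall t, D t -> derivable_within D f t) -> {within D, continuous f}.
Proof.
move=> df; apply/subspace_continuousP => t Dt.
have ft : f s @[s --> within D t^'] --> f t.
  have ct : (s - t) @[s --> within D t^'] --> t - t.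
    apply: cvgB; last exact: cvg_cst.
    move=> A [e /= e0 eA]; exists e => // s /= ts _ _; exact: eA.
  have := cvgM (derive_within_cvg (df t Dt)) ct.
  rewrite subrr mulr0 => h0.
  have FF : Filter (within D t^') by exact: within_filter.
  have h1 := cvgD (h0 FF) (@cvg_cst _ (f t) _ (within D t^') FF).
  rewrite add0r in h1; move=> A /h1[e /= e0 eA]; exists e => // s ts st Ds.
  have E : (f s - f t) / (s - t) * (s - t) + f t = f s.
    by rewrite divfK ?subr_eq0// subrK.
  by rewrite /= -E; exact: (eA s ts st Ds).
move=> A /[dup] Aft /ft [e /= e0 eA]; exists e => // s /= ts Ds.
have [->|st] := eqVneq s t; first exact: nbhs_singleton.
exact: eA.
Qed.

Lemma is_derive_within D f t : nbhs t D -> derivable_within D f t ->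
  is_derive t 1 f (derive_within D f t).
Proof.
move=> [r /= r0 rD] df.
have h : k^-1 *: ((f \o shift t) (k *: 1) - f t) @[k --> 0^'] -->
    derive_within D f t.
  move=> A /(derive_within_cvg df)[e /= e0 eA].
  exists (Num.min e r); first by rewrite /= lt_min e0.
  move=> k /=; rewrite sub0r normrN lt_min => /andP[ke kr] k0.
  have tk : t - (k + t) = - k by rewrite opprD addrCA subrr addr0.
  have := eA (k + t); rewrite /ball/= tk normrN ke => /(_ isT).
  have -> : k + t - t = k by rewrite addrK.
  rewrite -subr_eq0 addrK k0 => /(_ isT).
  have Dk : D (k + t) by apply: rD; rewrite /ball/= tk normrN.
  by move=> /(_ Dk); rewrite scaler1 mulrC.
have df1 : derivable f t 1 by apply/cvg_ex; eexists; exact: h.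
by apply: DeriveDef => //; exact: (cvg_lim _ h).
Qed.

(** Points strictly between [x] and [y] are interior to [D], where the relative derivative is the
    usual one; at [x] and [y] only continuity matters. *)
Lemma MVT_within D f (x y : R) : is_interval D ->
  (forall t, D t -> derivable_within D f t) -> D x -> D y -> x < y ->
  exists2 c, x < c < y & f y - f x = derive_within D f c * (y - x).
Proof.
move=> itvD df Dx Dy xy.
have xyD : `[x, y] `<=` D.
  move=> z; rewrite /= in_itv/= => xzy; exact: (itvD _ _ Dx Dy).
have [||c] := @MVT R f (derive_within D f) x y xy.
- move=> z zxy; apply: is_derive_within; last first.
    by apply: df; apply: xyD; exact: subset_itv_oo_cc.
  apply: (@filterS _ _ _ `]x, y[%classic).
    by move=> w wxy; apply: xyD; exact: subset_itv_oo_cc.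
  by apply: open_nbhs_nbhs; split => //; exact: itv_open.
- exact: continuous_subspaceW xyD (derivable_within_continuous df).
by rewrite in_itv/= => cxy; exists c.
Qed.

Lemma lipschitz_within D f (a b S : R) : is_interval D ->
  (forall t, D t -> derivable_within D f t) -> D a -> D b ->
  (forall t, a <= t <= b -> `|derive_within D f t| <= S) ->
  forall s t, a <= s <= b -> a <= t <= b -> `|f s - f t| <= S * `|s - t|.
Proof.
move=> itvD df Da Db dS.
suff lt_case s t : a <= s <= b -> a <= t <= b -> s < t ->
    `|f s - f t| <= S * `|s - t|.
  move=> s t sab tab; have [st|ts|->] := ltgtP s t.
  - exact: lt_case.
  - by rewrite distrC [`|s - t|]distrC; exact: lt_case.
  - by rewrite !subrr normr0 mulr0.
move=> sab tab st.
have [||c cst E] := MVT_within itvD df _ _ st.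
- exact: (itvD _ _ Da Db).
- exact: (itvD _ _ Da Db).
rewrite distrC E normrM [`|s - t|]distrC ler_wpM2r// dS//.
by move: sab tab cst => /andP[? ?] /andP[? ?] /andP[? ?]; apply/andP; split; lra.
Qed.

End derivative_within.

(** * From extended-real series to finite sums of step sizes *)

Section step_size_series.
Context {R : realType}.
Variable u : nat -> R.
Hypothesis u0 : forall n, (1 <= n)%N -> 0 <= u n.

Let partial m := \sum_(1 <= i < m) u i.

Let partialE m : (\sum_(1 <= i < m) (u i)%:E)%E = (partial m)%:E.
Proof. by rewrite sumEFin. Qed.

Let cvg_partial :
  (\sum_(1 <= i < m) (u i)%:E)%E @[m --> \oo] --> (\sum_(1 <= i <oo) (u i)%:E)%E.
Proof. by apply: is_cvg_nneseries => n n1 _; rewrite lee_fin u0. Qed.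

Let partial_le m : ((partial m)%:E <= \sum_(1 <= i <oo) (u i)%:E)%E.
Proof.
by rewrite -partialE; apply: nneseries_lim_ge => n n1 _; rewrite lee_fin u0.
Qed.

(** The recursion counts steps from 0 while the step sizes start at index 1, whence the shift. *)
Let partial_cat n m : (n <= m)%N ->
  \sum_(n <= k < m) u k.+1 = partial m.+1 - partial n.+1.
Proof.
move=> nm; rewrite /partial (@big_cat_nat _ _ _ n.+1 1 m.+1)//=.
by rewrite addrAC subrr add0r big_add1.
Qed.

Lemma series_diverges N (A : R) : (\sum_(1 <= n <oo) (u n)%:E = +oo)%E ->
  exists m, A < \sum_(N <= k < m) u k.+1.
Proof.
move=> sumoo; apply: contrapT => /forallNP h.
suff : (\sum_(1 <= i <oo) (u i)%:E <= (A + partial N.+1)%:E)%E.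
  by rewrite sumoo leye_eq.
rewrite -(cvg_lim _ cvg_partial)//; apply: lime_le.
  by apply/cvg_ex; eexists; exact: cvg_partial.
exists N.+1 => // -[//|m] /= Nm; rewrite partialE lee_fin.
have := h m; rewrite partial_cat// => /negP; rewrite -leNgt; lra.
Qed.

(** Partial sums never exceed their finite limit, so a late one within [e] of it bounds all later
    increments. *)
Lemma series_tail_small (e : R) :
  (\sum_(1 <= n <oo) (u n)%:E < +oo)%E -> 0 < e ->
  exists N, forall n m, (N <= n)%N -> \sum_(n <= k < m) u k.+1 <= e.
Proof.
move=> sumlt e0.
have sfin : (\sum_(1 <= i <oo) (u i)%:E)%E \is a fin_num.
  rewrite ge0_fin_numE//; apply: nneseries_ge0 => n n1 _.
  by rewrite lee_fin u0.
have cp : partial m @[m --> \oo] --> fine (\sum_(1 <= i <oo) (u i)%:E)%E.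
  have := cvg_partial; rewrite -{1}(fineK sfin) => /fine_cvg.
  by under eq_fun do rewrite /= partialE.
have /cvgrPdist_lt/(_ _ e0)[N _ hN] := cp.
exists N => n m Nn.
have [nm|/ltnW mn] := leqP n m; last by rewrite big_geq// ltW.
rewrite partial_cat//.
have := hN n.+1 (leqW Nn); rewrite /= ltr_norml => /andP[_ ?].
have := partial_le m.+1; rewrite -(fineK sfin) lee_fin => ?.
lra.
Qed.

End step_size_series.

(** * The parametric model *)

(* [phi_t^(-1)(X)] as a function of the noise [e], where [X = phi_theta(e)]. *)
Definition reparam {R : realType} (I1 : set R) (phi : R -> R -> R) (theta t e : R)
  : R := phi_inv I1 phi t (phi theta e).

Definition dreparam {R : realType} (Theta I1 : set R) (phi : R -> R -> R)
  (theta t e : R) : R := dphi_inv Theta I1 phi t (phi theta e).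

Section parametric_model.
Context {R : realType}.
Variables (Theta I1 I2 : set R) (phi : R -> R -> R) (theta : R).
Hypotheses (Theta_itv : is_interval Theta) (theta_Theta : Theta theta).
Hypothesis phi_bij : forall t, Theta t -> set_bij I1 I2 (phi t).
Hypothesis phi_incr : forall t, Theta t ->
  forall x y, I1 x -> I1 y -> x < y -> phi t x < phi t y.
Hypothesis phi_inv_C1 : forall x, I2 x ->
  C1_on Theta (fun t => phi_inv I1 phi t x).

Local Notation psi := (reparam I1 phi theta).
Local Notation Dpsi := (dreparam Theta I1 phi theta).

Let phi_theta_I2 e : I1 e -> I2 (phi theta e).
Proof. by have [phif _ _] := phi_bij theta_Theta; exact: phif. Qed.

Let psi_I1 t e : Theta t -> I1 e -> I1 (psi t e).
Proof.
move=> tT /phi_theta_I2 Ie; have [_ _ phis] := phi_bij tT.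
by apply: (surjpinv_image_sub phis); exists (phi theta e).
Qed.

Let phi_psi t e : Theta t -> I1 e -> phi t (psi t e) = phi theta e.
Proof.
move=> tT /phi_theta_I2 Ie; have [_ _ phis] := phi_bij tT.
by rewrite /reparam /phi_inv pinvK// inE; exact: phis.
Qed.

Lemma reparam_self e : I1 e -> psi theta e = e.
Proof.
move=> Ie; have [_ phii _] := phi_bij theta_Theta.
by rewrite /reparam /phi_inv pinvKV// inE.
Qed.

(** An increasing map followed by the inverse of an increasing map is nondecreasing on [I1]. *)
Lemma borel_on_reparam t : Theta t -> borel_on I1 (psi t).
Proof.
move=> tT; apply: borel_on_nondecreasing => x y Ix Iy xy.
rewrite leNgt; apply/negP => yx.
have := phi_incr tT (psi_I1 tT Iy) (psi_I1 tT Ix) yx.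
rewrite !phi_psi// => hlt.
have [xy'|yx'|E] := ltgtP x y.
- by have := lt_trans hlt (phi_incr theta_Theta Ix Iy xy'); rewrite ltxx.
- by rewrite ltNge xy in yx'.
- by rewrite E ltxx in hlt.
Qed.

Lemma derivable_reparam t e : Theta t -> I1 e ->
  derivable_within Theta (psi ^~ e) t.
Proof. by move=> tT /phi_theta_I2/phi_inv_C1[h _]; exact: h. Qed.

Lemma continuous_dreparam e : I1 e -> {within Theta, continuous (Dpsi ^~ e)}.
Proof. by move=> /phi_theta_I2/phi_inv_C1[]. Qed.

(** The derivative is the limit of difference quotients along one sequence of parameters; [x < y]
    ensures that such a sequence exists in [Theta]. *)
Lemma borel_on_dreparam x y t : Theta x -> Theta y -> x < y -> Theta t ->
  borel_on I1 (Dpsi t).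
Proof.
move=> Tx Ty xy Tt.
have Pr := within_dnbhs_proper Theta_itv Tx Ty xy Tt.
have /choice[u uP] : forall n, exists s : R,
    [/\ Theta s, s != t & `|t - s| < n.+1%:R^-1].
  move=> n.
  have : within Theta t^' [set s | [/\ Theta s, s != t & `|t - s| < n.+1%:R^-1]].
    by exists n.+1%:R^-1; [rewrite /= invr_gt0|move=> s].
  by move=> /filter_ex[s]; exists s.
have ut : u n @[n --> \oo] --> t.
  apply/cvgrPdist_lt => r r0; near=> n.
  have [_ _ /lt_trans] := uP n; apply.
  near: n; exact: (near_infty_natSinv_lt (PosNum r0)).
apply: (@borel_on_cvg _ _ (fun n e => (psi (u n) e - psi t e) / (u n - t))).
  move=> n; apply: borel_onM; last exact/borel_on_measurable/measurable_cst.
  by apply: borel_onB; apply: borel_on_reparam => //; have [] := uP n.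
move=> e Ie.
have /derive_within_cvg/cvg_dnbhs_withinP := derivable_reparam Tt Ie.
by apply => // n; have [] := uP n.
Unshelve. all: by end_near. Qed.

End parametric_model.

(* [Theta] may extend beyond [a, b], in which case the derivatives relative to
   [Theta] at [a] and [b] involve points outside [a, b]. *)
Lemma compact_itv_nbhs {R : realType} (Theta : set R) (a b : R) :
  is_interval Theta -> a <= b -> Theta a -> Theta b ->
  exists alpha beta r : R, [/\ alpha <= a /\ b <= beta, Theta alpha /\ Theta beta,
    0 < r & forall s t, Theta s -> a <= t <= b -> `|t - s| < r ->
      alpha <= s <= beta].
Proof.
move=> itv ab Ta Tb.
have [alpha [r1 [ala Tal r10 left]]] : exists alpha r, [/\ alpha <= a, Theta alpha,
    0 < r & forall s t, Theta s -> a <= t -> `|t - s| < r -> alpha <= s].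
  (* Either [Theta] has a point to the left of [a], which serves as [alpha], or [a] is its left end
     point and any radius works. *)
  have [[x [Tx xa]]|h] := pselect (exists x, Theta x /\ x < a).
    exists x, (a - x); split; rewrite ?subr_gt0//; first exact: ltW.
    by move=> s t _ at_; rewrite ltr_norml => /andP[_]; lra.
  exists a, 1; split => // s t Ts _ _.
  by rewrite leNgt; apply/negP => sa; apply: h; exists s.
have [beta [r2 [beb Tbe r20 right]]] : exists beta r, [/\ b <= beta, Theta beta,
    0 < r & forall s t, Theta s -> t <= b -> `|t - s| < r -> s <= beta].
  have [[x [Tx xb]]|h] := pselect (exists x, Theta x /\ b < x).
    exists x, (x - b); split; rewrite ?subr_gt0//; first exact: ltW.
    by move=> s t _ tb; rewrite ltr_norml => /andP[+ _]; lra.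
  exists b, 1; split => // s t Ts _ _.
  by rewrite leNgt; apply/negP => sb; apply: h; exists s.
exists alpha, beta, (Num.min r1 r2); split => //; first by rewrite lt_min r10.
move=> s t Ts /andP[at_ tb]; rewrite lt_min => /andP[h1 h2].
by rewrite (left s t)// (right s t).
Qed.

(** * Differentiation of the mean square error under the expectation *)

Section mean_square_error.
Context {d : measure_display} {T : measurableType d} {R : realType}.
Variables (P : probability T R) (D J : set R) (psi : R -> R -> R) (e : T -> R).
Variables (alpha beta theta : R) (S : R -> R).
Hypotheses (itvD : is_interval D) (Da : D alpha) (Db : D beta).
Hypothesis psi_derivable : forall t x, D t -> J x ->
  derivable_within D (psi ^~ x) t.
Hypotheses (theta_itv : alpha <= theta <= beta)
  (psi_theta : forall x, J x -> psi theta x = x).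
Hypothesis borel_psi : forall t, alpha <= t <= beta -> borel_on J (psi t).
Hypothesis dpsi_le : forall t x, alpha <= t <= beta -> J x ->
  `|derive_within D (psi ^~ x) t| <= S x.
Hypotheses (me : measurable_fun [set: T] e) (eJ : forall w, J (e w)).
Hypothesis iS2 : P.-integrable [set: T] (EFin \o (fun w => S (e w) ^+ 2)).

Lemma increment_le s t x : alpha <= s <= beta -> alpha <= t <= beta -> J x ->
  `|psi s x - psi t x| <= S x * `|s - t|.
Proof.
move=> sab tab Jx.
apply: (@lipschitz_within _ D (psi ^~ x) alpha beta) => //.
- by move=> z Dz; exact: psi_derivable.
- by move=> z zab; exact: dpsi_le.
Qed.

Lemma bound_ge0 x : J x -> 0 <= S x.
Proof. by move=> Jx; exact: le_trans (normr_ge0 _) (dpsi_le theta_itv Jx). Qed.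

(** Since [psi theta x = x], the deviation is an increment of [psi] between two parameters. *)
Lemma deviation_le t x : alpha <= t <= beta -> J x ->
  `|psi t x - x| <= (beta - alpha) * S x.
Proof.
move=> tab Jx; rewrite -{2}(psi_theta Jx).
apply: le_trans (increment_le tab theta_itv Jx) _.
rewrite mulrC ler_wpM2r ?bound_ge0// ler_norml.
by move: tab theta_itv => /andP[? ?] /andP[? ?]; apply/andP; split; lra.
Qed.

Let mpsi t : alpha <= t <= beta ->
  measurable_fun [set: T] (fun w => psi t (e w)).
Proof. by move=> tab; apply: borel_on_comp (borel_psi tab) me eJ. Qed.

Let iSS k : P.-integrable [set: T] (EFin \o (fun w => k * S (e w) ^+ 2)).
Proof.
by have := integrableZl measurableT k iS2; exact: eq_integrable.
Qed.

Let ab : alpha <= beta.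
Proof. by case/andP: theta_itv => *; lra. Qed.

Lemma integrable_square_error t : alpha <= t <= beta ->
  P.-integrable [set: T] (EFin \o (fun w => (psi t (e w) - e w) ^+ 2)).
Proof.
move=> tab; apply: le_integrable (iSS ((beta - alpha) ^+ 2)) => //.
  apply/measurable_EFinP; apply: measurable_funX.
  by apply: measurable_funB => //; exact: mpsi.
move=> w _ /=; rewrite lee_fin -exprMn !ger0_norm ?sqr_ge0//.
have S0 : 0 <= (beta - alpha) * S (e w).
  by rewrite mulr_ge0 ?subr_ge0 ?bound_ge0.
rewrite -real_normK ?num_real// ler_sqr ?nnegrE//.
exact: deviation_le.
Qed.

Lemma derive_within_mean_square_error (F : R -> R) (t r : R) :
  (forall s, alpha <= s <= beta -> F s = \int[P]_w (psi s (e w) - e w) ^+ 2) ->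
  alpha <= t <= beta -> alpha < beta -> 0 < r ->
  (forall s, D s -> `|t - s| < r -> alpha <= s <= beta) ->
  derive_within D F t =
  \int[P]_w (- 2 * derive_within D (psi ^~ (e w)) t * (e w - psi t (e w))).
Proof.
move=> FE tab ab' r0 nbh.
have Dab s : alpha <= s <= beta -> D s by exact: itvD.
have Pr := within_dnbhs_proper itvD Da Db ab' (Dab _ tab).
apply: (@cvg_lim _ (@norm_hausdorff _ _)).
(* Close to [t], the points of [D] lie in [[alpha, beta]], where the domination by [S] is
   available. *)
suff : (F s - F t) / (s - t) @[s --> within `[alpha, beta] t^'] -->
    \int[P]_w (- 2 * derive_within D (psi ^~ (e w)) t * (e w - psi t (e w))).
  move=> h A /h[k /= k0 kA]; exists (Num.min k r); first by rewrite /= lt_min k0.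
  move=> s /=; rewrite lt_min => /andP[sk sr] st Ds.
  by apply: kA => //=; rewrite in_itv/=; exact: nbh.
apply/cvg_dnbhs_withinP => u uab ut.
have uab' n : alpha <= u n <= beta by have := (uab n).1; rewrite /= in_itv.
have ut0 n : u n - t != 0 by rewrite subr_eq0; exact: (uab n).2.
pose q n w := (psi (u n) (e w) - psi t (e w)) / (u n - t).
(* A difference of two squares factors, which isolates the difference quotient [q n] of [psi]. *)
have E n : (F (u n) - F t) / (u n - t) =
    \int[P]_w (q n w * (psi (u n) (e w) + psi t (e w) - 2 * e w)).
  have i1 := integrable_square_error (uab' n).
  have i2 := integrable_square_error tab.
  rewrite !FE// -RintegralB// -RintegralZr//; last first.
    by have := integrableB measurableT i1 i2; exact: eq_integrable.
  apply: eq_Rintegral => w _; rewrite /q.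
  by rewrite mulrAC; congr (_ / _); ring.
under eq_fun do rewrite E.
have mq n : measurable_fun [set: T] (q n).
  apply: measurable_funM; last exact: measurable_cst.
  by apply: measurable_funB; exact: mpsi.
(* [S] bounds [q n] by the mean value theorem, and [2 * (beta - alpha) * S] bounds the other
   factor. *)
apply: (dominated_cvg_Rintegral
  (g := fun w => (2 * (beta - alpha)) * S (e w) ^+ 2)) => //.
- move=> n; apply: measurable_funM => //; apply: measurable_funB.
    by apply: measurable_funD; exact: mpsi.
  by apply: measurable_funM => //; exact: measurable_cst.
- move=> w _.
  have cq : q n w @[n --> \oo] --> derive_within D (psi ^~ (e w)) t.
    have /derive_within_cvg/cvg_dnbhs_withinP := psi_derivable (Dab _ tab) (eJ w).
    by apply => // n; split; [exact: Dab|exact: (uab n).2].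
  have cp : psi (u n) (e w) @[n --> \oo] --> psi t (e w).
    apply: (@continuous_within_seq _ D (psi ^~ (e w))) => //.
    + by apply: derivable_within_continuous => z Dz; exact: psi_derivable.
    + exact: Dab.
    + by move=> n; exact: Dab.
  rewrite (_ : - 2 * _ * _ = derive_within D (psi ^~ (e w)) t *
    (psi t (e w) + psi t (e w) - 2 * e w)); last by ring.
  apply: cvgM => //; apply: cvgB; last exact: cvg_cst.
  by apply: cvgD => //; exact: cvg_cst.
- move=> n w _; rewrite normrM.
  have S0 := bound_ge0 (eJ w).
  have q_le : `|q n w| <= S (e w).
    rewrite /q normrM normfV ler_pdivrMr ?normr_gt0//.
    exact: increment_le.
  have d1 := deviation_le (uab' n) (eJ w).
  have d2 := deviation_le tab (eJ w).
  have d3 : `|psi (u n) (e w) + psi t (e w) - 2 * e w| <=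
      2 * ((beta - alpha) * S (e w)).
    rewrite (_ : _ + _ - _ = (psi (u n) (e w) - e w) + (psi t (e w) - e w)).
      by apply: le_trans (ler_normD _ _) _; lra.
    by ring.
  apply: le_trans (ler_pM _ _ q_le d3) _ => //.
  by rewrite le_eqVlt; apply/orP; left; apply/eqP; ring.
Qed.

End mean_square_error.

(** * The parametric model as an instance of the abstract recursion *)

Theorem theorem3p1 (R : realType)
  (d : measure_display) (T : measurableType d) (P : probability T R)
  (Theta I1 I2 : set R) (phi : R -> R -> R) (theta : R)
  (eps_ : nat -> {RV P >-> R}) (eps : {RV P >-> R})
  (a b theta0 : R) (gamma : nat -> R)
  (Theta_itv : is_interval Theta) (theta_Theta : Theta theta)
  (eps_indep : independent_rvs eps_)
  (eps_id : forall n, same_distribution (eps_ n) eps)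
  (eps_I1 : forall n w, I1 (eps_ n w))
  (eps0_I1 : forall w, I1 (eps w))
  (phi_bij : forall t, Theta t -> set_bij I1 I2 (phi t))
  (phi_incr : forall t, Theta t ->
     forall x y, I1 x -> I1 y -> x < y -> phi t x < phi t y)
  (phi_inv_C1 : forall x, I2 x -> C1_on Theta (fun t => phi_inv I1 phi t x))
  (phi_inv_L2 : forall t, Theta t ->
     ('E_P[fun w => (`|phi_inv I1 phi t (phi theta (eps w))| ^+ 2)%R]
        < +oo)%E)
  (dphi_inv_L4 : forall B : set R, compact B -> B `<=` Theta ->
     (\int[P]_w ereal_sup
        [set (`|dphi_inv Theta I1 phi t (phi theta (eps w))| ^+ 4)%:E
          | t in B] < +oo)%E)
  (a_lt_b : a < b) (ab_Theta : `[a, b] `<=` Theta)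
  (theta_ab : a < theta < b)
  (M'_sign : forall t, a <= t <= b -> t != theta ->
     0 < (t - theta) * derive_within Theta (M I1 phi theta eps) t)
  (theta0_ab : a <= theta0 <= b)
  (gamma_gt0 : forall n, (1 <= n)%N -> 0 < gamma n)
  (gamma_decr : forall m n, (1 <= m <= n)%N -> gamma n <= gamma m)
  (gamma_sum : (\sum_(1 <= n <oo) (gamma n)%:E = +oo)%E)
  (gamma_sum2 : (\sum_(1 <= n <oo) ((gamma n ^+ 2)%R)%:E < +oo)%E) :
  {ae P, forall w,
    theta_hat Theta I1 phi theta a b theta0 gamma eps_ n w @[n --> \oo]
      --> theta}.
Proof.
have [ta tb] : a < theta /\ theta < b by case/andP: theta_ab.
have ab : a <= b by exact: ltW.
have Ta : Theta a by apply: ab_Theta; rewrite /= in_itv/= lexx.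
have Tb : Theta b by apply: ab_Theta; rewrite /= in_itv/= lexx andbT.
have [alpha [beta [r [[ala beb] [Tal Tbe] r0 nbh]]]] :=
  compact_itv_nbhs Theta_itv ab Ta Tb.
have sub t : a <= t <= b -> alpha <= t <= beta.
  by case/andP => *; apply/andP; split; lra.
have alb : alpha < beta by lra.
have thB : alpha <= theta <= beta by apply: sub; rewrite !ltW.
have BT t : alpha <= t <= beta -> Theta t by exact: Theta_itv.
have BT' : `[alpha, beta] `<=` Theta.
  by move=> t; rewrite /= in_itv; exact: BT.
pose psi := reparam I1 phi theta.
pose D := dreparam Theta I1 phi theta.
have bD t : alpha <= t <= beta -> borel_on I1 (D t).
  move=> tB.
  exact: (borel_on_dreparam Theta_itv theta_Theta phi_bij phi_incr phi_inv_C1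
    Tal Tbe alb (BT _ tB)).
have bpsi t : alpha <= t <= beta -> borel_on I1 (psi t).
  move=> tB; exact: (borel_on_reparam theta_Theta phi_bij phi_incr (BT _ tB)).
have dpsi t x : Theta t -> I1 x -> derivable_within Theta (psi ^~ x) t.
  by move=> Tt Ix; exact: (derivable_reparam theta_Theta phi_bij phi_inv_C1).
have psi_id x : I1 x -> psi theta x = x.
  by move=> Ix; exact: (reparam_self theta_Theta phi_bij).
have cD x : I1 x -> {within Theta, continuous (D ^~ x)}.
  by move=> Ix; exact: (continuous_dreparam theta_Theta phi_bij phi_inv_C1).
(* [S] is a Borel function equal on [I1] to the supremum of the derivatives over [[alpha, beta]];
   the fourth moment hypothesis on this compact set controls it. *)
have [|S [mS S_ge S_max]] := borel_sup_itv (ltW alb) bD.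
  by move=> x /cD; exact: continuous_subspaceW.
have S_ge0 x : I1 x -> 0 <= S x.
  by move=> /S_max[t _ ->].
have meps : measurable_fun [set: T] eps by exact: measurable_funPT.
have mSeps : measurable_fun [set: T] (fun w => S (eps w)).
  exact: measurableT_comp.
have S4 : P.-integrable [set: T] (EFin \o (fun w => S (eps w) ^+ 4)).
  apply/integrableP; split; first by apply/measurable_EFinP; exact: measurable_funX.
  have := dphi_inv_L4 `[alpha, beta]%classic (@segment_compact _ _ _) BT'.
  apply: le_lt_trans.
  rewrite le_eqVlt; apply/orP; left; apply/eqP; apply: eq_integral => w _.
  have Iw := eps0_I1 w; rewrite /= ger0_norm ?exprn_ge0 ?S_ge0//.
  apply/eqP; rewrite eq_le; apply/andP; split.
    have [t tB ->] := S_max _ Iw.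
    by apply: ereal_sup_ubound; exists t => //=; rewrite in_itv.
  apply: ge_ereal_sup => _ [t /= tB <-]; rewrite lee_fin.
  rewrite in_itv/= in tB; apply: lerXn2r; rewrite ?nnegrE ?S_ge0//.
  exact: S_ge.
have S2 : P.-integrable [set: T] (EFin \o (fun w => S (eps w) ^+ 2)).
  have i1 : P.-integrable [set: T] (EFin \o (fun w => 1 + S (eps w) ^+ 4)).
    have := integrableD measurableT
      (finite_measure_integrable_cst P 1 measurableT) S4.
    exact: eq_integrable.
  apply: le_integrable i1 => //.
    by apply/measurable_EFinP; exact: measurable_funX.
  move=> w _ /=; rewrite lee_fin !ger0_norm ?addr_ge0 ?exprn_ge0 ?S_ge0//.
  rewrite (_ : S (eps w) ^+ 4 = (S (eps w) ^+ 2) ^+ 2); last by rewrite -exprM.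
  have := sqr_ge0 (S (eps w)); move: (S (eps w) ^+ 2) => s; nra.
have dev t x : alpha <= t <= beta -> I1 x ->
    `|psi t x - x| <= (beta - alpha) * S x.
  exact: (deviation_le Theta_itv Tal Tbe dpsi thB psi_id S_ge).
(* The increment [T_(n+1)] as a function of the current estimate and of the new noise. *)
pose f t x := - 2 * D t x * (x - psi t x).
have bf t : a <= t <= b -> borel_on I1 (f t).
  move=> /sub tB; apply: borel_onM; last first.
    by apply: borel_onB; [exact: borel_on_measurable|exact: bpsi].
  by apply: borel_onM; [exact/borel_on_measurable/measurable_cst|exact: bD].
(* [F t] is a Borel function agreeing with [f t] on [I1]; for [t] outside [[a, b]] its choice is
   arbitrary. *)
have /choice[F FP] : forall t, exists g : R -> R,
    a <= t <= b -> measurable_fun [set: R] g /\ {in I1, g =1 f t}.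
  move=> t; have [tab|ntab] := boolP (a <= t <= b); last by exists (f t).
  by have [g mg gE] := bf t tab; exists g.
have FE t x : a <= t <= b -> I1 x -> F t x = f t x.
  by move=> tab Ix; rewrite (FP t tab).2// inE.
have cF : caratheodory a b I1 F.
  split=> [t /FP[]//|x u t Ix uab tab ut].
  rewrite FE//; under eq_fun do rewrite FE//.
  have Tu n : Theta (u n) by exact/BT/sub.
  have Tt : Theta t by exact/BT/sub.
  apply: cvgM.
    apply: cvgM; first exact: cvg_cst.
    exact: (continuous_within_seq (cD _ Ix) Tt Tu ut).
  apply: cvgB; first exact: cvg_cst.
  apply: (@continuous_within_seq _ Theta (psi ^~ x)) => //.
  by apply: derivable_within_continuous => s Ts; exact: dpsi.
(* One factor [S] bounds the derivative and [(beta - alpha) * S] bounds the deviation. The fourth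
   moment of [S] makes [Sf] square integrable. *)
pose Sf x := 2 * (beta - alpha) * S x ^+ 2.
have mSf : measurable_fun [set: R] Sf.
  by apply: measurable_funM; [exact: measurable_cst|exact: measurable_funX].
have iSf : P.-integrable [set: T] (EFin \o (fun w => Sf (eps w) ^+ 2)).
  have := integrableZl measurableT ((2 * (beta - alpha)) ^+ 2) S4.
  apply: eq_integrable => // w _ /=.
  by rewrite /Sf -EFinM; congr (_%:E); ring.
have fS t x : a <= t <= b -> I1 x -> `|F t x| <= Sf x.
  move=> tab Ix; rewrite FE// /f !normrM normrN (ger0_norm (ler0n R 2)).
  have h1 := S_ge _ _ (sub _ tab) Ix.
  have h2 := dev _ _ (sub _ tab) Ix; rewrite distrC in h2.
  have := ler_pM (normr_ge0 _) (normr_ge0 _) h1 h2.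
  by rewrite /Sf; lra.
have ME s : alpha <= s <= beta ->
    M I1 phi theta eps s = \int[P]_w (psi s (eps w) - eps w) ^+ 2.
  move=> _; rewrite /M unlock /Rintegral; congr fine.
  by apply: eq_integral => w _; rewrite real_normK ?num_real.
have sign t : a <= t <= b -> t != theta ->
    0 < (t - theta) * \int[P]_w F t (eps w).
  move=> tab tt; have := M'_sign t tab tt.
  (* The mean of the increment is the derivative of [M], so the sign hypothesis carries over to
     [F]. *)
  rewrite (derive_within_mean_square_error Theta_itv Tal Tbe dpsi thB psi_id
    bpsi S_ge meps eps0_I1 S2 ME (sub _ tab) alb r0); last first.
    by move=> s Ts; exact: nbh.
  congr (0 < _ * _); apply: eq_Rintegral => w _.
  by rewrite FE.
have Y_ab n w : a <= theta_hat Theta I1 phi theta a b theta0 gamma eps_ n w <= b.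
  by case: n => [//|n]; exact: proj_itv.
apply: (@robbins_monro_cvg _ _ _ P eps_ eps a b theta theta0
  (fun n => gamma n.+1) I1 F Sf) => //.
- by move=> n; exact: gamma_gt0.
- by move=> N A; apply: series_diverges => // n n1; exact/ltW/gamma_gt0.
- move=> e e0; apply: (series_tail_small (u := fun n => gamma n ^+ 2)) => // n _.
  exact: sqr_ge0.
- by move=> n w; rewrite FE.
Qed.
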